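(* Let $\mathbb{X}$ be a Cartesian tangent category with a differential curve object $C$, and let $e:C\to C$ be the solution of the system $(C,\Delta^C,u)$. Then $e$ is a differential exponential map on $C$ in the Cartesian differential category of differential objects of $\mathbb{X}$, and thus $C$ acquires the structure of a differential exponential rig (with map $e$), with unit $0e:1\to C$ and multiplication $$C\times C\xrightarrow{\langle 0,1\rangle\times\langle 1,0\rangle}C\times C\times C\times C\xrightarrow{D^2(e)}C.$$
   Context: Composition is written in diagrammatic order: $fg$ means first $f$, then $g$. A tangent category is a category $\mathbb{X}$ with a functor $T:\mathbb{X}\to\mathbb{X}$ and natural transformations $p:T\to 1$, $0:1\to T$, $+:T_2\to T$, $\ell:T\to T^2$, $c:T^2\to T^2$ such that: (1) for all $M,n$ the fibre power $T_nM$ of $n$ copies of $p_M:TM\to M$ exists and is preserved by every $T^k$; (2) $(p_M,+_M,0_M)$ is an additive bundle, i.e. a commutative monoid in $\mathbb{X}/M$; (3) $(\ell_M,0_M)$ is an additive bundle morphism (commuting square preserving addition and zero) from $(p_M,+_M,0_M)$ to $(T(p_M),T(+_M),T(0_M))$, and $(c_M,1_{TM})$ is one from $(T(p_M),T(+_M),T(0_M))$ to $(p_{TM},+_{TM},0_{TM})$; (4) $cc=1$, $\ell c=\ell$, $\ell T(\ell)=\ell\ell_T$, $T(c)c_TT(c)=c_TT(c)c_T$, $\ell_TT(c)c_T=cT(\ell)$; (5) with $v:=\langle\pi_0\ell,\pi_10_{TM}\rangle T(+):T_2M\to T^2M$, the square $vT(p)=\pi_0p0$ exhibits $T_2M$ as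 the pullback of $T(p_M)$ along $0_M$, and this pullback is preserved by every $T^k$. It is Cartesian if it has finite products (terminal object $1$, unique maps to it written $!$) and $T$ preserves them; $T(A\times B)$ is identified with $TA\times TB$. Object subscripts are often omitted. Differential bundles. A differential bundle $(q:A\to M,\lambda,\sigma,\zeta)$ is an additive bundle $(q,\sigma:A_2\to A,\zeta:M\to A)$ whose fibre powers $A_n$ exist and are preserved by every $T^k$, with a lift $\lambda:A\to TA$ such that $(\lambda,0_M)$ is an additive bundle morphism from $(q,\sigma,\zeta)$ to $(T(q),T(\sigma),T(\zeta))$, $(\lambda,\zeta)$ is one from $(q,\sigma,\zeta)$ to $(p_A,+_A,0_A)$, $\lambda\ell_A=\lambda T(\lambda)$, and, with $\mu:=\langle\pi_00,\pi_1\lambda\rangle T(\sigma):A_2\to TA$, the square $\mu T(q)=\pi_0q0$ exhibits $A_2$ as the pullback of $T(q)$ along $0_M$, preserved by every $T^k$. Differential objects. A differential object is a commutative monoid $(A,\sigma,\zeta)$ with a map $\hat p:TA\to A$ such that $(p,\hat p)$ exhibits $TA$ as $A\times A$, $0\hat p=\,!\zeta$, $+\hat p=\langle\pi_0\hat p,\pi_1\hat p\rangle\sigma$, $T(\sigma)\hat p=(\hat p\times\hat p)\sigma$, $T(\zeta)\hat p=\zeta$, $\ell T(\hat p)\hat p=\hat p$. It is a differential bundle over $1$ with lift $\lambda$ determined by $\lambda p=\,!\zeta$, $\lambda\hat p=1_A$. The differential objects and all maps of $\mathbb{X}$ between them form a Cartesian differential category: for $f:A\to B$, $D(f):A\times A\to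 B$ is $T(f)\hat p$ under the identification $\langle p,\hat p\rangle:TA\cong A\times A$ (first argument the point, second the vector), and $D^2(f)=D(D(f)):A\times A\times A\times A\to B$. In this setting the monoid operations $\sigma,\zeta$ of a differential object are written $+,0$. Systems and curve objects. A vector field on $M$ is $V:M\to TM$ with $Vp=1_M$. A dynamical system $(M,V,g)$ is a vector field $V$ on $M$ with $g:1\to M$. Given a dynamical system $(C,c_1,c_0)$, a (parameterized) system $(M,V,g)$ is a vector field $V$ on $M$ with $g:X\to M$; a solution is $\gamma:C\times X\to M$ with $\langle !c_0,1\rangle\gamma=g$ and $(c_1\times 0)T(\gamma)=\gamma V$ (for $X=1$ one identifies $C\times1$ with $C$). A curve object is a dynamical system $(C,c_1,c_0)$ such that every system has at most one solution, $c_1T(c_1)c=c_1T(c_1)$, and $(C,c_1,1_C)$ has a solution. $V$ is complete if $(M,V,1_M)$ has a solution (then every $(M,V,g)$ does). A linear vector field on a differential bundle $q:A\to M$ is a pair of vector fields $V^A$ on $A$, $V^M$ on $M$ with $V^AT(q)=qV^M$ and $\lambda T(V^A)=V^AT(\lambda)c$. A curve object satisfies linear completeness if whenever $(V^A,V^M)$ is a linear vector field on a differential bundle and $V^M$ is complete, then $V^A$ is complete. A differential curve object is a curve object $(C,c_1,c_0)$ satisfying linear completeness with a differential object structure $(\hat p,\sigma,\zeta)$ on $C$ such that $c_0=\zeta$ and $c_1\hat p=\,!u$, where $u:=c_0c_1\hat p:1\to C$. The vector field $\Delta^C:C\to TC$ is determined by $\Delta^Cp=1_C$, $\Delta^C\hat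 p=1_C$; it is complete by linear completeness, so $e:C\to C$ exists and is characterized by $c_0e=u$ and $c_1T(e)=e\Delta^C$. In a Cartesian differential category, a differential exponential map on $A$ is a map $e:A\to A$ with $\langle 0,1\rangle D(e)=1_A$ and $(1\times e)D(e)=+e:A\times A\to A$. A differential exponential rig is a commutative monoid $(A,\bullet:A\times A\to A,u:1\to A)$ with a map $e:A\to A$ such that $\bullet$ is linear in each variable (for differential objects: $(\lambda\times0)T(\bullet)=\bullet\lambda=(0\times\lambda)T(\bullet)$), $(e\times1)\bullet=D(e)$, $0e=u$, and $+e=(e\times e)\bullet$. *)

(* Defs.v *)
From mathcomp Require Import all_boot.

Set Implicit Arguments.
Unset Strict Implicit.
Unset Printing Implicit Defensive.

Declare Scope cat_scope.
Local Open Scope cat_scope.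

(* Composition is written in diagrammatic order: f \; g is 'first f, then g'. *)
Record category := Category {
  Ob :> Type;
  Hom : Ob -> Ob -> Type;
  idm : forall A, Hom A A;
  comp : forall A B C, Hom A B -> Hom B C -> Hom A C;
  comp1m : forall A B (f : Hom A B), comp (idm A) f = f;
  compm1 : forall A B (f : Hom A B), comp f (idm B) = f;
  compA : forall A B C D (f : Hom A B) (g : Hom B C) (h : Hom C D),
    comp f (comp g h) = comp (comp f g) h }.

Arguments Hom {_} _ _.
Arguments idm {_} _.
Arguments comp {_ _ _ _} _ _.

Notation "A ~> B" := (Hom A B) (at level 70, no associativity) : cat_scope.
Notation "f \; g" := (comp f g) : cat_scope.

Record endofunctor (X : category) := Endofunctor {
  Fob :> X -> X;
  fmap : forall A B, A ~> B -> Fob A ~> Fob B;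
  fmap1 : forall A, fmap (idm A) = idm (Fob A);
  fmapM : forall A B C (f : A ~> B) (g : B ~> C),
    fmap (f \; g) = fmap f \; fmap g }.

Arguments fmap {_} _ {_ _} _.
Arguments fmap1 {_} _ _.
Arguments fmapM {_} _ {_ _ _} _ _.

Definition idF (X : category) : endofunctor X.
Proof. by exists id (fun A B f => f). Defined.

Definition compF (X : category) (F G : endofunctor X) : endofunctor X.
Proof.
exists (fun A => G (F A)) (fun A B f => fmap G (fmap F f)).
- by move=> A; rewrite !fmap1.
- by move=> A B C f g; rewrite !fmapM.
Defined.

Fixpoint iterF (X : category) (F : endofunctor X) (k : nat) : endofunctor X :=
  if k is k'.+1 then compF F (iterF F k') else idF X.

Record nat_trans (X : category) (F G : endofunctor X) := NatTrans {
  ntc :> forall A, F A ~> G A;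
  ntN : forall A B (f : A ~> B), fmap F f \; ntc B = ntc A \; fmap G f }.

(* The universal properties carry their mediating maps as data, so that
   pairings can be written as terms; uniqueness makes this data unique. *)

Record terminal_lim (X : category) (t : X) := TerminalLim {
  tl_bang : forall Z : X, Z ~> t;
  tl_unique : forall (Z : X) (f g : Z ~> t), f = g }.

Record product_lim (X : category) (A B P : X) (a : P ~> A) (b : P ~> B) :=
  ProductLim {
  pl_pair : forall Z : X, Z ~> A -> Z ~> B -> Z ~> P;
  pl_pair1 : forall (Z : X) (f : Z ~> A) (g : Z ~> B), pl_pair f g \; a = f;
  pl_pair2 : forall (Z : X) (f : Z ~> A) (g : Z ~> B), pl_pair f g \; b = g;
  pl_unique : forall (Z : X) (h k : Z ~> P),
    h \; a = k \; a -> h \; b = k \; b -> h = k }.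

Arguments pl_pair {_ _ _ _ _ _} _ {_} _ _.

Record pullback_lim (X : category) (A B C P : X) (f : A ~> C) (g : B ~> C)
    (a : P ~> A) (b : P ~> B) := PullbackLim {
  pb_comm : a \; f = b \; g;
  pb_lift : forall (Z : X) (x : Z ~> A) (y : Z ~> B),
    x \; f = y \; g -> Z ~> P;
  pb_lift1 : forall (Z : X) (x : Z ~> A) (y : Z ~> B) (H : x \; f = y \; g),
    pb_lift H \; a = x;
  pb_lift2 : forall (Z : X) (x : Z ~> A) (y : Z ~> B) (H : x \; f = y \; g),
    pb_lift H \; b = y;
  pb_unique : forall (Z : X) (h k : Z ~> P),
    h \; a = k \; a -> h \; b = k \; b -> h = k }.

(* [b : P ~> B] is the [n]-fold fibre power of [q : E ~> B]; for [n = 0] this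
   says that [b] is an isomorphism. *)
Record fibre_power_lim (X : category) (n : nat) (E B P : X) (q : E ~> B)
    (b : P ~> B) (pr : 'I_n -> P ~> E) := FibrePowerLim {
  fp_comm : forall i, pr i \; q = b;
  fp_lift : forall (Z : X) (z : Z ~> B) (f : 'I_n -> Z ~> E),
    (forall i, f i \; q = z) -> Z ~> P;
  fp_lift_base : forall (Z : X) (z : Z ~> B) (f : 'I_n -> Z ~> E)
    (H : forall i, f i \; q = z), fp_lift H \; b = z;
  fp_lift_proj : forall (Z : X) (z : Z ~> B) (f : 'I_n -> Z ~> E)
    (H : forall i, f i \; q = z) i, fp_lift H \; pr i = f i;
  fp_unique : forall (Z : X) (h k : Z ~> P),
    h \; b = k \; b -> (forall i, h \; pr i = k \; pr i) -> h = k }.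

(* A pullback square preserved by every T^k; T^0 being the identity functor,
   the square itself is a pullback. *)
Definition stable_pullback (X : category) (T : endofunctor X) (A B C P : X)
    (f : A ~> C) (g : B ~> C) (a : P ~> A) (b : P ~> B) :=
  forall k, pullback_lim (fmap (iterF T k) f) (fmap (iterF T k) g)
                         (fmap (iterF T k) a) (fmap (iterF T k) b).

(* A fibre power preserved by every T^k (again k = 0 is the fibre power). *)
Record fibre_power (X : category) (T : endofunctor X) (n : nat) (E B : X)
    (q : E ~> B) := FibrePower {
  fp_ob :> X;
  fp_base : fp_ob ~> B;
  fp_proj : 'I_n -> fp_ob ~> E;
  fp_stable : forall k,
    fibre_power_lim (fmap (iterF T k) q) (fmap (iterF T k) fp_base)
                    (fun i => fmap (iterF T k) (fp_proj i)) }.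

Arguments fp_base {_ _ _ _ _ _} _.
Arguments fp_proj {_ _ _ _ _ _} _ _.
Arguments fp_stable {_ _ _ _ _ _} _ _.

Definition fp_limit (X : category) (T : endofunctor X) (n : nat) (E B : X)
    (q : E ~> B) (P : fibre_power T n q) :
  fibre_power_lim q (fp_base P) (fp_proj P) := fp_stable P 0.

(* T(E_n) as the n-th fibre power of T(q) *)
Definition fp_tangent (X : category) (T : endofunctor X) (n : nat) (E B : X)
    (q : E ~> B) (P : fibre_power T n q) : fibre_power T n (fmap T q) :=
  @FibrePower X T n (T E) (T B) (fmap T q) (T P)
    (fmap T (fp_base P)) (fun i => fmap T (fp_proj P i))
    (fun k => fp_stable P k.+1).

Definition fp0 (X : category) (T : endofunctor X) (E B : X) (q : E ~> B)
  (P : fibre_power T 2 q) : P ~> E := fp_proj P ord0.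
Definition fp1 (X : category) (T : endofunctor X) (E B : X) (q : E ~> B)
  (P : fibre_power T 2 q) : P ~> E := fp_proj P ord_max.

Lemma fp_pairP (X : category) (Z E B : X) (q : E ~> B) (x y : Z ~> E)
    (H : x \; q = y \; q) (i : 'I_2) :
  (if i == ord0 then x else y) \; q = x \; q.
Proof. by case: ifP. Qed.

Definition fp_pair (X : category) (T : endofunctor X) (E B : X) (q : E ~> B)
    (P : fibre_power T 2 q) (Z : X) (x y : Z ~> E) (H : x \; q = y \; q) :
  Z ~> P := fp_lift (fp_limit P) (fp_pairP H).

Arguments fp_pair {_ _ _ _ _} _ {_ _ _} _.

Lemma fp_pair0 (X : category) (T : endofunctor X) (E B : X) (q : E ~> B)
    (P : fibre_power T 2 q) (Z : X) (x y : Z ~> E) (H : x \; q = y \; q) :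
  fp_pair P H \; fp0 P = x.
Proof. exact: (fp_lift_proj (fp_limit P) (fp_pairP H) ord0). Qed.

Lemma fp_pair1 (X : category) (T : endofunctor X) (E B : X) (q : E ~> B)
    (P : fibre_power T 2 q) (Z : X) (x y : Z ~> E) (H : x \; q = y \; q) :
  fp_pair P H \; fp1 P = y.
Proof. exact: (fp_lift_proj (fp_limit P) (fp_pairP H) ord_max). Qed.

Lemma fp01 (X : category) (T : endofunctor X) (E B : X) (q : E ~> B)
    (P : fibre_power T 2 q) : fp0 P \; q = fp1 P \; q.
Proof. by rewrite /fp0 /fp1 !(fp_comm (fp_limit P)). Qed.

Lemma fp2_unique (X : category) (T : endofunctor X) (E B : X) (q : E ~> B)
    (P : fibre_power T 2 q) (Z : X) (h k : Z ~> P) :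
  h \; fp0 P = k \; fp0 P -> h \; fp1 P = k \; fp1 P -> h = k.
Proof.
move=> H0 H1; apply: (fp_unique (fp_limit P)).
  by rewrite -(fp_comm (fp_limit P) ord0) !compA -/(fp0 P) H0.
move=> i; case: (ord0 =P i) => [<-//|/eqP Hi].
by have -> : i = ord_max by case: i Hi => [[|[|?]]] // ? _; apply: val_inj.
Qed.

Lemma fp_mapP (X : category) (T : endofunctor X) (E B E' B' : X) (q : E ~> B)
    (q' : E' ~> B') (P : fibre_power T 2 q) (f : E ~> E') (g : B ~> B')
    (H : f \; q' = q \; g) :
  (fp0 P \; f) \; q' = (fp1 P \; f) \; q'.
Proof. by rewrite -!compA H !compA fp01. Qed.

(* f_2 := <pi_0 f, pi_1 f> : E_2 ~> E'_2 *)
Definition fp_map (X : category) (T : endofunctor X) (E B E' B' : X)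
    (q : E ~> B) (q' : E' ~> B') (P : fibre_power T 2 q)
    (P' : fibre_power T 2 q') (f : E ~> E') (g : B ~> B')
    (H : f \; q' = q \; g) : P ~> P' := fp_pair P' (fp_mapP P H).

Arguments fp_map {_ _ _ _ _ _ _ _} _ _ {_ _} _.

(* The fibre powers are part of the bundle and are preserved by every T^k;
   this holds for p_M, for differential bundles, and for their images under
   T. *)
Record bundle (X : category) (T : endofunctor X) (E B : X) := Bundle {
  bq : E ~> B;
  bpow : forall n, fibre_power T n bq;
  badd : bpow 2 ~> E;
  bzero : B ~> E }.

Arguments bq {_ _ _ _} _.
Arguments bpow {_ _ _ _} _ _.
Arguments badd {_ _ _ _} _.
Arguments bzero {_ _ _ _} _.

(* Commutative monoid in X/B.  The monoid laws are stated on generalized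
   elements of E over B.  The equalities making the pairings well defined are
   quantified over: they all follow from the preceding ones. *)
Record additive_bundle (X : category) (T : endofunctor X) (E B : X)
    (b : bundle T E B) : Prop := AdditiveBundle {
  ab_zeroq : bzero b \; bq b = idm B;
  ab_addq : badd b \; bq b = fp_base (bpow b 2);
  ab_addC : forall (Z : X) (x y : Z ~> E) (xy : x \; bq b = y \; bq b)
      (yx : y \; bq b = x \; bq b),
    fp_pair (bpow b 2) xy \; badd b = fp_pair (bpow b 2) yx \; badd b;
  ab_addA : forall (Z : X) (x y z : Z ~> E) (xy : x \; bq b = y \; bq b)
      (yz : y \; bq b = z \; bq b)
      (xy_z : (fp_pair (bpow b 2) xy \; badd b) \; bq b = z \; bq b)
      (x_yz : x \; bq b = (fp_pair (bpow b 2) yz \; badd b) \; bq b),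
    fp_pair (bpow b 2) xy_z \; badd b = fp_pair (bpow b 2) x_yz \; badd b;
  ab_add0 : forall (Z : X) (x : Z ~> E)
      (H : (x \; bq b \; bzero b) \; bq b = x \; bq b),
    fp_pair (bpow b 2) H \; badd b = x }.

Record additive_morphism (X : category) (T : endofunctor X) (E B E' B' : X)
    (b : bundle T E B) (b' : bundle T E' B') (f : E ~> E') (g : B ~> B') :
    Prop := AdditiveMorphism {
  am_sq : f \; bq b' = bq b \; g;
  am_add : badd b \; f = fp_map (bpow b 2) (bpow b' 2) am_sq \; badd b';
  am_zero : bzero b \; f = g \; bzero b' }.

(* (T(q), T(sigma), T(zeta)) *)
Definition bundle_tangent (X : category) (T : endofunctor X) (E B : X)
    (b : bundle T E B) : bundle T (T E) (T B) :=
  @Bundle X T (T E) (T B) (fmap T (bq b)) (fun n => fp_tangent (bpow b n))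
    (fmap T (badd b)) (fmap T (bzero b)).

Definition T2F (X : category) (T : endofunctor X) (p : nat_trans T (idF X))
    (Tpow : forall n M, fibre_power T n (p M)) : endofunctor X.
Proof.
exists (fun M => Tpow 2 M)
       (fun A B f => fp_map (Tpow 2 A) (Tpow 2 B) (ntN p f)).
- move=> A; apply: fp2_unique;
  by rewrite /fp_map ?fp_pair0 ?fp_pair1 fmap1 compm1 comp1m.
- move=> A B C f g; apply: fp2_unique;
  rewrite /fp_map -compA ?fp_pair0 ?fp_pair1 !compA ?fp_pair0 ?fp_pair1;
  by rewrite fmapM compA.
Defined.

Record tangent_data (X : category) := TangentData {
  td_T : endofunctor X;
  td_p : nat_trans td_T (idF X);
  td_pow : forall n M, fibre_power td_T n (td_p M);
  td_zero : nat_trans (idF X) td_T;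
  td_plus : nat_trans (T2F td_pow) td_T;
  td_ell : nat_trans td_T (compF td_T td_T);
  td_c : nat_trans (compF td_T td_T) (compF td_T td_T) }.

(* (p_M, +_M, 0_M) *)
Definition td_bundle (X : category) (D : tangent_data X) (M : X) :
    bundle (td_T D) (td_T D M) M :=
  @Bundle X (td_T D) (td_T D M) M (td_p D M) (fun n => td_pow D n M)
    (td_plus D M) (td_zero D M).

Lemma td_vP (X : category) (D : tangent_data X) (M : X)
    (H : td_ell D M \; fmap (td_T D) (td_p D M) = td_p D M \; td_zero D M) :
  (fp0 (td_pow D 2 M) \; td_ell D M) \; fmap (td_T D) (td_p D M)
  = (fp1 (td_pow D 2 M) \; td_zero D (td_T D M)) \; fmap (td_T D) (td_p D M).
Proof.
have -> : (fp1 (td_pow D 2 M) \; td_zero D (td_T D M))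
            \; fmap (td_T D) (td_p D M)
        = fp1 (td_pow D 2 M) \; td_p D M \; td_zero D M.
  by rewrite -compA -(ntN (td_zero D)).
by rewrite -compA H !compA fp01.
Qed.

(* v := <pi_0 l, pi_1 0_T> T(+) *)
Definition td_v (X : category) (D : tangent_data X) (M : X)
    (H : td_ell D M \; fmap (td_T D) (td_p D M) = td_p D M \; td_zero D M) :
    td_pow D 2 M ~> td_T D (td_T D M) :=
  fp_pair (fp_tangent (td_pow D 2 M)) (td_vP H)
  \; fmap (td_T D) (td_plus D M).

Record tangent_category := TangentCategory {
  tc_cat :> category;
  tc_data : tangent_data tc_cat;
  tc_additive : forall M, additive_bundle (td_bundle tc_data M);
  tc_ell_additive : forall M,
    additive_morphism (td_bundle tc_data M)
      (bundle_tangent (td_bundle tc_data M))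
      (td_ell tc_data M) (td_zero tc_data M);
  tc_c_additive : forall M,
    additive_morphism (bundle_tangent (td_bundle tc_data M))
      (td_bundle tc_data (td_T tc_data M))
      (td_c tc_data M) (idm (td_T tc_data M));
  tc_cc : forall M,
    td_c tc_data M \; td_c tc_data M = idm (td_T tc_data (td_T tc_data M));
  tc_ellc : forall M, td_ell tc_data M \; td_c tc_data M = td_ell tc_data M;
  tc_ell_ell : forall M,
    td_ell tc_data M \; fmap (td_T tc_data) (td_ell tc_data M)
    = td_ell tc_data M \; td_ell tc_data (td_T tc_data M);
  tc_yang_baxter : forall M,
    fmap (td_T tc_data) (td_c tc_data M) \; td_c tc_data (td_T tc_data M)
      \; fmap (td_T tc_data) (td_c tc_data M)
    = td_c tc_data (td_T tc_data M) \; fmap (td_T tc_data) (td_c tc_data M)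
      \; td_c tc_data (td_T tc_data M);
  tc_ell_c : forall M,
    td_ell tc_data (td_T tc_data M) \; fmap (td_T tc_data) (td_c tc_data M)
      \; td_c tc_data (td_T tc_data M)
    = td_c tc_data M \; fmap (td_T tc_data) (td_ell tc_data M);
  tc_v_pullback : forall M,
    stable_pullback (td_T tc_data)
      (fmap (td_T tc_data) (td_p tc_data M)) (td_zero tc_data M)
      (td_v (am_sq (tc_ell_additive M)))
      (fp0 (td_pow tc_data 2 M) \; td_p tc_data M) }.

Definition T {X : tangent_category} : endofunctor X := td_T (tc_data X).
Definition p {X : tangent_category} : nat_trans T (idF X) :=
  td_p (tc_data X).
Definition zeroT {X : tangent_category} : nat_trans (idF X) T :=
  td_zero (tc_data X).
Definition Tpow {X : tangent_category} (n : nat) (M : X) :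
  fibre_power T n (p M) := td_pow (tc_data X) n M.
Definition plusT {X : tangent_category} (M : X) : Tpow 2 M ~> T M :=
  td_plus (tc_data X) M.
Definition ell {X : tangent_category} : nat_trans T (compF T T) :=
  td_ell (tc_data X).
Definition cflip {X : tangent_category} : nat_trans (compF T T) (compF T T) :=
  td_c (tc_data X).
Definition tbundle {X : tangent_category} (M : X) : bundle T (T M) M :=
  td_bundle (tc_data X) M.

Lemma db_muP (X : tangent_category) (A M : X) (b : bundle T A M)
    (lam : A ~> T A) (H : lam \; fmap T (bq b) = bq b \; zeroT M) :
  (fp0 (bpow b 2) \; zeroT A) \; fmap T (bq b)
  = (fp1 (bpow b 2) \; lam) \; fmap T (bq b).
Proof.
have E : zeroT A \; fmap T (bq b) = bq b \; zeroT M.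
  by rewrite -(ntN zeroT).
by rewrite -!compA H E !compA fp01.
Qed.

(* mu := <pi_0 0, pi_1 lambda> T(sigma) *)
Definition db_mu (X : tangent_category) (A M : X) (b : bundle T A M)
    (lam : A ~> T A) (H : lam \; fmap T (bq b) = bq b \; zeroT M) :
    bpow b 2 ~> T A :=
  fp_pair (fp_tangent (bpow b 2)) (db_muP H) \; fmap T (badd b).

Record differential_bundle (X : tangent_category) (A M : X) :=
  DifferentialBundle {
  db_bundle :> bundle T A M;
  db_lift : A ~> T A;
  db_additive : additive_bundle db_bundle;
  db_lift_T : additive_morphism db_bundle (bundle_tangent db_bundle)
                db_lift (zeroT M);
  db_lift_p : additive_morphism db_bundle (tbundle A)
                db_lift (bzero db_bundle);
  db_lift_ell : db_lift \; ell A = db_lift \; fmap T db_lift;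
  db_pullback :
    stable_pullback T (fmap T (bq db_bundle)) (zeroT M)
      (db_mu (am_sq db_lift_T)) (fp0 (bpow db_bundle 2) \; bq db_bundle) }.

Record cartesian_tangent_category := CartesianTangentCategory {
  ctc_tc :> tangent_category;
  one : ctc_tc;
  one_lim : terminal_lim one;
  prd : ctc_tc -> ctc_tc -> ctc_tc;
  prd1 : forall A B, prd A B ~> A;
  prd2 : forall A B, prd A B ~> B;
  prd_lim : forall A B, product_lim (prd1 A B) (prd2 A B);
  T_one_lim : terminal_lim (T one);
  T_prd_lim : forall A B,
    product_lim (fmap T (prd1 A B)) (fmap T (prd2 A B)) }.

Arguments one {_}.
Arguments prd {_} _ _.
Arguments prd1 {_} _ _.
Arguments prd2 {_} _ _.

Notation "A ** B" := (prd A B) (at level 40, left associativity) : cat_scope.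

Definition bang {X : cartesian_tangent_category} (A : X) : A ~> one :=
  tl_bang (one_lim X) A.

Definition pairm {X : cartesian_tangent_category} {Z A B : X}
  (f : Z ~> A) (g : Z ~> B) : Z ~> A ** B := pl_pair (prd_lim A B) f g.

Notation "⟨ f , g ⟩" := (pairm f g) (format "⟨ f ,  g ⟩") : cat_scope.

Definition prd_map {X : cartesian_tangent_category} {A A' B B' : X}
  (f : A ~> A') (g : B ~> B') : A ** B ~> A' ** B' :=
  ⟨prd1 A B \; f, prd2 A B \; g⟩.

Notation "f ⊗ g" := (prd_map f g)
  (at level 45, left associativity) : cat_scope.

(* The identification T(A ** B) = T A ** T B, in both directions *)
Definition Tsplit {X : cartesian_tangent_category} (A B : X) :
  T (A ** B) ~> T A ** T B := ⟨fmap T (prd1 A B), fmap T (prd2 A B)⟩.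
Definition Tjoin {X : cartesian_tangent_category} (A B : X) :
  T A ** T B ~> T (A ** B) :=
  pl_pair (T_prd_lim A B) (prd1 (T A) (T B)) (prd2 (T A) (T B)).

Lemma pairm1 (X : cartesian_tangent_category) (Z A B : X)
  (f : Z ~> A) (g : Z ~> B) : ⟨f, g⟩ \; prd1 A B = f.
Proof. exact: pl_pair1. Qed.

Lemma pairm2 (X : cartesian_tangent_category) (Z A B : X)
  (f : Z ~> A) (g : Z ~> B) : ⟨f, g⟩ \; prd2 A B = g.
Proof. exact: pl_pair2. Qed.

Lemma prd_eq (X : cartesian_tangent_category) (Z A B : X)
    (h k : Z ~> A ** B) :
  h \; prd1 A B = k \; prd1 A B -> h \; prd2 A B = k \; prd2 A B -> h = k.
Proof. exact: pl_unique (prd_lim A B) _ _ _. Qed.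

Lemma comp_pair (X : cartesian_tangent_category) (Y Z A B : X)
  (h : Y ~> Z) (f : Z ~> A) (g : Z ~> B) : h \; ⟨f, g⟩ = ⟨h \; f, h \; g⟩.
Proof. by apply: prd_eq; rewrite -compA ?pairm1 ?pairm2. Qed.

Lemma one_eq (X : cartesian_tangent_category) (Z : X) (f g : Z ~> one) : f = g.
Proof. exact: tl_unique (one_lim X) _ _ _. Qed.

(* The laws are stated on generalized elements. *)
Record comm_monoid (X : cartesian_tangent_category) (A : X)
    (m : A ** A ~> A) (u : one ~> A) : Prop := CommMonoid {
  cm_C : forall (Z : X) (x y : Z ~> A), ⟨x, y⟩ \; m = ⟨y, x⟩ \; m;
  cm_A : forall (Z : X) (x y z : Z ~> A),
    ⟨⟨x, y⟩ \; m, z⟩ \; m = ⟨x, ⟨y, z⟩ \; m⟩ \; m;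
  cm_1 : forall (Z : X) (x : Z ~> A), ⟨bang Z \; u, x⟩ \; m = x }.

Record diffobj (X : cartesian_tangent_category) := DiffObj {
  do_ob :> X;
  sigma : do_ob ** do_ob ~> do_ob;
  zeta : one ~> do_ob;
  phat : T do_ob ~> do_ob;
  do_monoid : comm_monoid sigma zeta;
  do_lim : product_lim (p do_ob) phat;
  do_zeroT : zeroT do_ob \; phat = bang do_ob \; zeta;
  do_plusT : plusT do_ob \; phat
    = ⟨fp0 (Tpow 2 do_ob) \; phat, fp1 (Tpow 2 do_ob) \; phat⟩ \; sigma;
  do_Tsigma : fmap T sigma \; phat
    = Tsplit do_ob do_ob \; (phat ⊗ phat) \; sigma;
  do_Tzeta : fmap T zeta \; phat = bang (T one) \; zeta;
  do_ell : ell do_ob \; fmap T phat \; phat = phat }.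

Arguments sigma {_} _.
Arguments zeta {_} _.
Arguments phat {_} _.
Arguments do_lim {_} _.

(* x |-> 0, at an arbitrary stage of definition Z *)
Definition zeroAt {X : cartesian_tangent_category} (Z : X) (A : diffobj X) :
  Z ~> A := bang Z \; zeta A.

(* The inverse A ** A ~> T A of <p, phat> *)
Definition do_join {X : cartesian_tangent_category} (A : diffobj X) :
  A ** A ~> T A := pl_pair (do_lim A) (prd1 A A) (prd2 A A).

(* The lift of A as a differential bundle over 1 *)
Definition do_lift {X : cartesian_tangent_category} (A : diffobj X) :
  A ~> T A := pl_pair (do_lim A) (zeroAt A A) (idm A).

Definition D {X : cartesian_tangent_category} {A B : diffobj X} (f : A ~> B) :
  A ** A ~> B := do_join A \; fmap T f \; phat B.

Lemma TsplitE (X : cartesian_tangent_category) (A B C E : X)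
    (f : T A ~> C) (g : T B ~> E) :
  Tsplit A B \; (f ⊗ g)
  = ⟨fmap T (prd1 A B) \; f, fmap T (prd2 A B) \; g⟩.
Proof. by rewrite /prd_map comp_pair !compA pairm1 pairm2. Qed.

Lemma pairm_map (X : cartesian_tangent_category) (Z A B C E : X)
    (x : Z ~> A) (y : Z ~> B) (f : A ~> C) (g : B ~> E) :
  ⟨x, y⟩ \; (f ⊗ g) = ⟨x \; f, y \; g⟩.
Proof. by rewrite /prd_map comp_pair !compA pairm1 pairm2. Qed.

Section ProductDiffObj.
Context (X : cartesian_tangent_category) (A B : diffobj X).

Definition dp_phat : T (A ** B) ~> A ** B := Tsplit A B \; (phat A ⊗ phat B).

Definition dp_sigma : (A ** B) ** (A ** B) ~> A ** B :=
  ⟨(prd1 A B ⊗ prd1 A B) \; sigma A, (prd2 A B ⊗ prd2 A B) \; sigma B⟩.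

Definition dp_zeta : one ~> A ** B := ⟨zeta A, zeta B⟩.

Lemma dp_phat1 (Z : X) (h : Z ~> T (A ** B)) :
  (h \; dp_phat) \; prd1 A B = (h \; fmap T (prd1 A B)) \; phat A.
Proof. by rewrite /dp_phat TsplitE -compA pairm1 compA. Qed.

Lemma dp_phat2 (Z : X) (h : Z ~> T (A ** B)) :
  (h \; dp_phat) \; prd2 A B = (h \; fmap T (prd2 A B)) \; phat B.
Proof. by rewrite /dp_phat TsplitE -compA pairm2 compA. Qed.

Lemma dp_sigma1 (Z : X) (x y : Z ~> A ** B) :
  (⟨x, y⟩ \; dp_sigma) \; prd1 A B
  = ⟨x \; prd1 A B, y \; prd1 A B⟩ \; sigma A.
Proof. by rewrite /dp_sigma -compA pairm1 compA pairm_map. Qed.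

Lemma dp_sigma2 (Z : X) (x y : Z ~> A ** B) :
  (⟨x, y⟩ \; dp_sigma) \; prd2 A B
  = ⟨x \; prd2 A B, y \; prd2 A B⟩ \; sigma B.
Proof. by rewrite /dp_sigma -compA pairm2 compA pairm_map. Qed.

Lemma dp_zeta1 (Z : X) (h : Z ~> one) :
  (h \; dp_zeta) \; prd1 A B = h \; zeta A.
Proof. by rewrite /dp_zeta -compA pairm1. Qed.

Lemma dp_zeta2 (Z : X) (h : Z ~> one) :
  (h \; dp_zeta) \; prd2 A B = h \; zeta B.
Proof. by rewrite /dp_zeta -compA pairm2. Qed.

Lemma dp_monoid : comm_monoid dp_sigma dp_zeta.
Proof.
split=> [Z x y|Z x y z|Z x]; apply: prd_eq;
  rewrite !(dp_sigma1, dp_sigma2, dp_zeta1, dp_zeta2).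
- exact: cm_C (do_monoid A) _ _ _.
- exact: cm_C (do_monoid B) _ _ _.
- exact: cm_A (do_monoid A) _ _ _ _.
- exact: cm_A (do_monoid B) _ _ _ _.
- exact: cm_1 (do_monoid A) _ _.
- exact: cm_1 (do_monoid B) _ _.
Qed.

Definition dp_lim : product_lim (p (A ** B)) dp_phat.
Proof.
have p1 Z (h : Z ~> T (A ** B)) :
    (h \; p (A ** B)) \; prd1 A B = (h \; fmap T (prd1 A B)) \; p A.
  by rewrite -!compA (ntN p).
have p2 Z (h : Z ~> T (A ** B)) :
    (h \; p (A ** B)) \; prd2 A B = (h \; fmap T (prd2 A B)) \; p B.
  by rewrite -!compA (ntN p).
exists (fun Z f g => pl_pair (T_prd_lim A B)
  (pl_pair (do_lim A) (f \; prd1 A B) (g \; prd1 A B))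
  (pl_pair (do_lim B) (f \; prd2 A B) (g \; prd2 A B))).
- move=> Z f g; apply: prd_eq; rewrite ?p1 ?p2.
  + by rewrite !pl_pair1.
  + by rewrite pl_pair2 pl_pair1.
- move=> Z f g; apply: prd_eq; rewrite ?dp_phat1 ?dp_phat2.
  + by rewrite pl_pair1 pl_pair2.
  + by rewrite !pl_pair2.
- move=> Z h k hp hq; apply: (pl_unique (T_prd_lim A B)).
  + apply: (pl_unique (do_lim A)).
      by rewrite -!p1 hp.
    by rewrite -!dp_phat1 hq.
  + apply: (pl_unique (do_lim B)).
      by rewrite -!p2 hp.
    by rewrite -!dp_phat2 hq.
Defined.

Lemma dp_zeroT : zeroT (A ** B) \; dp_phat = bang (A ** B) \; dp_zeta.
Proof.
have z1 : zeroT (A ** B) \; fmap T (prd1 A B) = prd1 A B \; zeroT A.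
  by rewrite -(ntN zeroT).
have z2 : zeroT (A ** B) \; fmap T (prd2 A B) = prd2 A B \; zeroT B.
  by rewrite -(ntN zeroT).
apply: prd_eq.
- rewrite dp_phat1 dp_zeta1 z1 -compA do_zeroT compA.
  by congr (_ \; _); exact: one_eq.
- rewrite dp_phat2 dp_zeta2 z2 -compA do_zeroT compA.
  by congr (_ \; _); exact: one_eq.
Qed.

Lemma plusTN (M N : X) (f : M ~> N) :
  plusT M \; fmap T f = fp_map (Tpow 2 M) (Tpow 2 N) (ntN p f) \; plusT N.
Proof. by symmetry; exact: (ntN (td_plus (tc_data X)) f). Qed.

Lemma dp_plusT : plusT (A ** B) \; dp_phat
  = ⟨fp0 (Tpow 2 (A ** B)) \; dp_phat, fp1 (Tpow 2 (A ** B)) \; dp_phat⟩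
    \; dp_sigma.
Proof.
apply: prd_eq.
- rewrite dp_phat1 dp_sigma1 !dp_phat1 plusTN -compA do_plusT compA comp_pair.
  by rewrite !compA fp_pair0 fp_pair1.
- rewrite dp_phat2 dp_sigma2 !dp_phat2 plusTN -compA do_plusT compA comp_pair.
  by rewrite !compA fp_pair0 fp_pair1.
Qed.

Lemma dp_Tsigma : fmap T dp_sigma \; dp_phat
  = Tsplit (A ** B) (A ** B) \; (dp_phat ⊗ dp_phat) \; dp_sigma.
Proof.
rewrite [RHS]compA TsplitE; apply: prd_eq.
- rewrite dp_phat1 dp_sigma1 !dp_phat1 -!fmapM {1}/dp_sigma pairm1.
  rewrite fmapM -compA do_Tsigma [Tsplit _ _ \; _]compA TsplitE.
  by rewrite compA comp_pair !compA -!fmapM /prd_map pairm1 pairm2.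
- rewrite dp_phat2 dp_sigma2 !dp_phat2 -!fmapM {1}/dp_sigma pairm2.
  rewrite fmapM -compA do_Tsigma [Tsplit _ _ \; _]compA TsplitE.
  by rewrite compA comp_pair !compA -!fmapM /prd_map pairm1 pairm2.
Qed.

Lemma dp_Tzeta : fmap T dp_zeta \; dp_phat = bang (T one) \; dp_zeta.
Proof.
apply: prd_eq.
- by rewrite dp_phat1 dp_zeta1 -fmapM /dp_zeta pairm1 do_Tzeta.
- by rewrite dp_phat2 dp_zeta2 -fmapM /dp_zeta pairm2 do_Tzeta.
Qed.

Lemma dp_ell : ell (A ** B) \; fmap T dp_phat \; dp_phat = dp_phat.
Proof.
have l1 : ell (A ** B) \; fmap T (fmap T (prd1 A B))
        = fmap T (prd1 A B) \; ell A by rewrite (ntN ell).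
have l2 : ell (A ** B) \; fmap T (fmap T (prd2 A B))
        = fmap T (prd2 A B) \; ell B by rewrite (ntN ell).
have q1 : fmap T dp_phat \; fmap T (prd1 A B)
        = fmap T (fmap T (prd1 A B)) \; fmap T (phat A).
  by rewrite -!fmapM -(comp1m dp_phat) dp_phat1 comp1m.
have q2 : fmap T dp_phat \; fmap T (prd2 A B)
        = fmap T (fmap T (prd2 A B)) \; fmap T (phat B).
  by rewrite -!fmapM -(comp1m dp_phat) dp_phat2 comp1m.
have r1 : dp_phat \; prd1 A B = fmap T (prd1 A B) \; phat A.
  by rewrite -(comp1m dp_phat) dp_phat1 comp1m.
have r2 : dp_phat \; prd2 A B = fmap T (prd2 A B) \; phat B.
  by rewrite -(comp1m dp_phat) dp_phat2 comp1m.
rewrite compA; apply: prd_eq.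
- rewrite dp_phat1 r1 -(compA (ell (A ** B))) q1 compA l1.
  by rewrite -!compA do_ell.
- rewrite dp_phat2 r2 -(compA (ell (A ** B))) q2 compA l2.
  by rewrite -!compA do_ell.
Qed.

(* The product A x B in the Cartesian differential category of differential
   objects *)
Definition do_prd : diffobj X :=
  @DiffObj X (A ** B) dp_sigma dp_zeta dp_phat dp_monoid dp_lim
    dp_zeroT dp_plusT dp_Tsigma dp_Tzeta dp_ell.

End ProductDiffObj.

Definition D2 {X : cartesian_tangent_category} {A B : diffobj X}
    (f : A ~> B) : (A ** A) ** (A ** A) ~> B :=
  D (A := do_prd A A) (B := B) (D f).

Definition vector_field {X : tangent_category} {M : X} (V : M ~> T M) : Prop :=
  V \; p M = idm M.

Definition solution {X : cartesian_tangent_category} {C : X}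
    (c1 : C ~> T C) (c0 : one ~> C) {M Y : X} (V : M ~> T M) (g : Y ~> M)
    (gam : C ** Y ~> M) : Prop :=
  ⟨bang Y \; c0, idm Y⟩ \; gam = g /\
  (c1 ⊗ zeroT Y) \; Tjoin C Y \; fmap T gam = gam \; V.

(* The case Y = 1, where C ** 1 is identified with C by the projection *)
Definition solution1 {X : cartesian_tangent_category} {C : X}
    (c1 : C ~> T C) (c0 : one ~> C) {M : X} (V : M ~> T M) (g : one ~> M)
    (gam : C ~> M) : Prop :=
  solution c1 c0 V g (prd1 C one \; gam).

Definition complete {X : cartesian_tangent_category} {C : X}
    (c1 : C ~> T C) (c0 : one ~> C) {M : X} (V : M ~> T M) : Prop :=
  exists gam : C ** M ~> M, solution c1 c0 V (idm M) gam.

Record curve_object {X : cartesian_tangent_category} (C : X)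
    (c1 : C ~> T C) (c0 : one ~> C) : Prop := CurveObject {
  co_vector_field : vector_field c1;
  co_unique : forall (M Y : X) (V : M ~> T M) (g : Y ~> M)
      (gam gam' : C ** Y ~> M),
    vector_field V -> solution c1 c0 V g gam -> solution c1 c0 V g gam' ->
    gam = gam';
  co_commute : c1 \; fmap T c1 \; cflip C = c1 \; fmap T c1;
  co_solution : exists gam : C ** C ~> C, solution c1 c0 c1 (idm C) gam }.

Record linear_vector_field {X : tangent_category} {A M : X}
    (B : differential_bundle A M) (VA : A ~> T A) (VM : M ~> T M) : Prop :=
  LinearVectorField {
  lvf_A : vector_field VA;
  lvf_M : vector_field VM;
  lvf_q : VA \; fmap T (bq B) = bq B \; VM;
  lvf_lift : db_lift B \; fmap T VA = VA \; fmap T (db_lift B) \; cflip A }.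

Definition linear_completeness {X : cartesian_tangent_category} (C : X)
    (c1 : C ~> T C) (c0 : one ~> C) : Prop :=
  forall (A M : X) (B : differential_bundle A M) (VA : A ~> T A)
    (VM : M ~> T M),
  linear_vector_field B VA VM -> complete c1 c0 VM -> complete c1 c0 VA.

Record diff_curve_object (X : cartesian_tangent_category) := DiffCurveObject {
  dco_ob :> diffobj X;
  dco_c1 : dco_ob ~> T dco_ob;
  dco_c0 : one ~> dco_ob;
  dco_curve : curve_object dco_c1 dco_c0;
  dco_complete : linear_completeness dco_c1 dco_c0;
  dco_zeta : dco_c0 = zeta dco_ob;
  dco_unit : dco_c1 \; phat dco_ob
    = bang dco_ob \; (dco_c0 \; dco_c1 \; phat dco_ob) }.

Arguments dco_c1 {_} _.
Arguments dco_c0 {_} _.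

Definition dco_u {X : cartesian_tangent_category} (C : diff_curve_object X) :
  one ~> C := dco_c0 C \; dco_c1 C \; phat C.

Definition Delta {X : cartesian_tangent_category} (C : diffobj X) :
  C ~> T C := pl_pair (do_lim C) (idm C) (idm C).

Record diff_exp_map {X : cartesian_tangent_category} (A : diffobj X)
    (e : A ~> A) : Prop := DiffExpMap {
  dem_0 : ⟨zeroAt A A, idm A⟩ \; D e = idm A;
  dem_add : (idm A ⊗ e) \; D e = sigma A \; e }.

Record diff_exp_rig {X : cartesian_tangent_category} (A : diffobj X)
    (m : A ** A ~> A) (u : one ~> A) (e : A ~> A) : Prop := DiffExpRig {
  der_monoid : comm_monoid m u;
  der_linear1 : (do_lift A ⊗ zeroT A) \; Tjoin A A \; fmap T m
    = m \; do_lift A;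
  der_linear2 : (zeroT A ⊗ do_lift A) \; Tjoin A A \; fmap T m
    = m \; do_lift A;
  der_D : (e ⊗ idm A) \; m = D e;
  der_0 : zeta A \; e = u;
  der_add : sigma A \; e = (e ⊗ e) \; m }.

Arguments diff_exp_map {_} _ _.
Arguments diff_exp_rig {_} _ _ _ _.

(* Main.v *)
From mathcomp Require Import all_boot.
Require Import Defs.

(** Write D(f)(x, v) for the derivative of f at the point x along the vector v.
    A differential object C is a differential bundle over the terminal object,
    on which [Delta C] is a linear vector field ([Delta_linear]). Linear
    completeness therefore gives a flow of [Delta C], and the trajectory of [u]
    under it is the exponential e ([exp_exists]). Since c_1 is the constant
    vector field [u], a system on a differential object is an initial value
    problem with derivative taken along [u] ([solutionP]); thus e is the only
    map with e(0) = u and D(e)(x, u) = e(x). Everything else follows from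
    uniqueness of solutions ([system_unique]) and from two rules of the
    calculus of differential objects: D(f) is linear in the vector
    ([Dat_D_lin]), and second derivatives are symmetric ([Dat_D_sym]). Both come
    from coordinates on T(T(A)), where the canonical flip exchanges the two
    middle coordinates ([ttvec_flip]).

    A linear map f satisfies D(f)(x, u) = f(u), so it is the solution of a
    system determined by f(u); hence a map linear in one argument is determined
    by its values at [u] ([lin1_unique]). The map D(e)(0, -) is linear and sends
    [u] to e(0) = u, so it is the identity ([Dat_exp_0]), which is the first law
    of an exponential map. For the second, e(x + y) and D(e)(x, e(y)) both equal
    e(y) at x = 0, and both are their own derivative in x along [u], the second
    one by symmetry ([exp_add]).

    The product xy = D(D(e))((0, x), (y, 0)) is commutative by symmetry and
    bilinear by linearity of derivatives. Differentiating
    D(e)(x, e(y)) = e(x + y) in x, at 0 and along v, gives e(y) v = D(e)(y, v)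
    ([mul_exp]). At y = 0 this is the unit law, and together with the second
    exponential law it gives e(x + y) = e(x) e(y). Both sides of the associative
    law are linear in the first factor and agree when it is [u], so they are
    equal ([lin1_assoc]). *)

Set Implicit Arguments.
Unset Strict Implicit.
Unset Printing Implicit Defensive.
Local Open Scope cat_scope.

(** * Iterates of the tangent functor preserve products *)

Section Limits.
Context (X : cartesian_tangent_category).
Implicit Types A B M P Y Z : X.

Lemma T_terminal P : terminal_lim P -> terminal_lim (T P).
Proof.
move=> t; split=> [Z|].
  exact: (tl_bang (T_one_lim X) Z \; fmap T (tl_bang t one)).
move=> Z f g.
have E : bang P \; tl_bang t one = idm P by exact: tl_unique t _ _ _.
rewrite -(compm1 f) -(compm1 g) -(fmap1 T) -E fmapM !compA.
by congr (_ \; _); exact: tl_unique (T_one_lim X) _ _ _.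
Qed.

(** [T] is only assumed to preserve the chosen products; every other product of
    the same objects is isomorphic to the chosen one. *)
Lemma T_product A B P (a : P ~> A) (b : P ~> B) :
  product_lim a b -> product_lim (fmap T a) (fmap T b).
Proof.
move=> ab; pose i := pl_pair ab (prd1 A B) (prd2 A B).
have ia : i \; a = prd1 A B by exact: pl_pair1.
have ib : i \; b = prd2 A B by exact: pl_pair2.
have ji : ⟨a, b⟩ \; i = idm P.
  by apply: (pl_unique ab); rewrite -compA ?ia ?ib ?pairm1 ?pairm2 comp1m.
exists (fun Z f g => pl_pair (T_prd_lim A B) f g \; fmap T i).
- by move=> Z f g; rewrite -compA -fmapM ia pl_pair1.
- by move=> Z f g; rewrite -compA -fmapM ib pl_pair2.
- move=> Z h k ha hb; rewrite -(compm1 h) -(compm1 k) -(fmap1 T) -ji fmapM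
    !compA.
  congr (_ \; _); apply: (pl_unique (T_prd_lim A B));
    by rewrite -!compA -!fmapM ?pairm1 ?pairm2.
Qed.

Lemma iterT_terminal k P : terminal_lim P -> terminal_lim (iterF T k P).
Proof. by elim: k P => [|k IH] P tP //=; apply: IH; exact: T_terminal. Qed.

Lemma iterT_product k A B P (a : P ~> A) (b : P ~> B) :
  product_lim a b ->
  product_lim (fmap (iterF T k) a) (fmap (iterF T k) b).
Proof.
by elim: k A B P a b => [|k IH] A B P a b ab //=; apply: IH; exact: T_product.
Qed.

(** The [n]-fold power of [A], with its projections. *)
Fixpoint npow A n : X := if n is n'.+1 then A ** npow A n' else one.

Fixpoint nproj A n : 'I_n -> npow A n ~> A :=
  match n return 'I_n -> npow A n ~> A with
  | 0 => fun i => False_rect _ (notF (ltn_ord i))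
  | n'.+1 => fun i =>
      if unlift ord0 i is Some j then prd2 A (npow A n') \; nproj A j
      else prd1 A (npow A n')
  end.

Lemma nproj0 A n : nproj A (ord0 : 'I_n.+1) = prd1 A (npow A n).
Proof. by rewrite /= unlift_none. Qed.

Lemma nprojS A n (i : 'I_n) :
  nproj A (lift ord0 i) = prd2 A (npow A n) \; nproj A i.
Proof. by rewrite [LHS]/= liftK. Qed.

(** Over the terminal object a fibre power is a power. *)
Definition npow_lim A n k :
  fibre_power_lim (fmap (iterF T k) (bang A))
    (fmap (iterF T k) (bang (npow A n)))
    (fun i => fmap (iterF T k) (@nproj A n i)).
Proof.
set F := iterF T k.
have t1 : terminal_lim (F one) := iterT_terminal k (one_lim X).
have lift Z (f : 'I_n -> Z ~> F A) :
    {h : Z ~> F (npow A n) | forall i, h \; fmap F (nproj A i) = f i}.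
  elim: n f => [|n IH] f; first by exists (tl_bang t1 Z); case.
  have [h hE] := IH (fun j => f (lift ord0 j)).
  pose pr := iterT_product k (prd_lim A (npow A n)).
  exists (pl_pair pr (f ord0) h) => i.
  case: (unliftP ord0 i) => [j ->|->].
    by rewrite nprojS fmapM compA pl_pair2 hE.
  by rewrite nproj0 pl_pair1.
exists (fun Z z f _ => sval (lift Z f)).
- by move=> i; exact: tl_unique t1 _ _ _.
- by move=> Z z f H; exact: tl_unique t1 _ _ _.
- by move=> Z z f H i; case: (lift Z f).
- move=> Z h l _; elim: n {lift} h l => [|n IH] h l E.
    exact: tl_unique t1 _ _ _.
  apply: (pl_unique (iterT_product k (prd_lim A (npow A n)))).
    by have := E ord0; rewrite nproj0.
  by apply: IH => i; have := E (lift ord0 i); rewrite nprojS fmapM !compA.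
Qed.

Definition npow_fp A n : fibre_power T n (bang A) :=
  FibrePower (fun k => npow_lim A n k).

(** Over terminal [B] and [M], a square is a pullback as soon as its side [a] is
    invertible, and functors preserve invertibility. *)
Lemma iso_stable_pullback A B P M (f : A ~> M) (g : B ~> M) (a : P ~> A)
    (b : P ~> B) (a' : A ~> P) :
  terminal_lim B -> terminal_lim M -> a \; a' = idm P -> a' \; a = idm A ->
  stable_pullback T f g a b.
Proof.
move=> tB tM aa' a'a k; set F := iterF T k.
have tFB := iterT_terminal k tB; have tFM := iterT_terminal k tM.
have E1 : fmap F a \; fmap F a' = idm (F P) by rewrite -fmapM aa' fmap1.
have E2 : fmap F a' \; fmap F a = idm (F A) by rewrite -fmapM a'a fmap1.
exists (fun Z x y _ => x \; fmap F a').
- exact: tl_unique tFM _ _ _.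
- by move=> Z x y _; rewrite -compA E2 compm1.
- by move=> *; exact: tl_unique tFB _ _ _.
- by move=> Z h l Ea _; rewrite -(compm1 h) -(compm1 l) -E1 !compA Ea.
Qed.

End Limits.

(** * Naturality and coherence of the tangent structure *)

Section Tangent.
Context (X : cartesian_tangent_category).
Implicit Types M N Z : X.

(** The structural maps of the tangent functor, typed without the identity and
    composite functors in the types of the natural transformations. *)
Definition tproj (M : X) : T M ~> M := p M.
Definition tzero (M : X) : M ~> T M := zeroT M.
Definition tlift (M : X) : T M ~> T (T M) := ell M.
Definition tflip (M : X) : T (T M) ~> T (T M) := cflip M.

Lemma tprojN M N (f : M ~> N) : fmap T f \; tproj N = tproj M \; f.
Proof. exact (ntN p f). Qed.

Lemma tzeroN M N (f : M ~> N) : tzero M \; fmap T f = f \; tzero N.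
Proof. by symmetry; exact (ntN zeroT f). Qed.

Lemma tliftN M N (f : M ~> N) :
  tlift M \; fmap T (fmap T f) = fmap T f \; tlift N.
Proof. by symmetry; exact (ntN ell f). Qed.

Lemma tflipN M N (f : M ~> N) :
  tflip M \; fmap T (fmap T f) = fmap T (fmap T f) \; tflip N.
Proof. by symmetry; exact (ntN cflip f). Qed.

Lemma tzero_proj M : tzero M \; tproj M = idm M.
Proof. exact: ab_zeroq (tc_additive M). Qed.

Lemma tlift_Tproj M : tlift M \; fmap T (tproj M) = tproj M \; tzero M.
Proof. exact: am_sq (tc_ell_additive M). Qed.

Lemma tflip_proj M : tflip M \; tproj (T M) = fmap T (tproj M).
Proof.
by rewrite -[RHS]compm1; exact: am_sq (tc_c_additive M).
Qed.

Lemma tflip_Tproj M : tflip M \; fmap T (tproj M) = tproj (T M).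
Proof. by rewrite -tflip_proj compA [_ \; tflip M]tc_cc comp1m. Qed.

Lemma Ttzero_flip M : fmap T (tzero M) \; tflip M = tzero (T M).
Proof. by rewrite [LHS](am_zero (tc_c_additive M)) /= comp1m. Qed.

Lemma tzero_flip M : tzero (T M) \; tflip M = fmap T (tzero M).
Proof. by rewrite -Ttzero_flip -compA [_ \; tflip M]tc_cc compm1. Qed.

Lemma tlift_flip M : tlift M \; tflip M = tlift M.
Proof. exact: tc_ellc. Qed.

Lemma tlift_proj M : tlift M \; tproj (T M) = tproj M \; tzero M.
Proof. by rewrite -tflip_Tproj compA tlift_flip tlift_Tproj. Qed.

End Tangent.

Arguments tproj {X} M.
Arguments tzero {X} M.
Arguments tlift {X} M.
Arguments tflip {X} M.

(** * Coordinates on the tangent objects of a differential object *)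

Section DiffObj.
Context (X : cartesian_tangent_category).
Implicit Types A B : diffobj X.
Implicit Types Y Z : X.

(** Pointwise addition of generalized elements of a differential object. *)
Definition add A Z (x y : Z ~> A) : Z ~> A := ⟨x, y⟩ \; sigma A.

Lemma addC A Z (x y : Z ~> A) : add x y = add y x.
Proof. exact: cm_C (do_monoid A) _ _ _. Qed.

Lemma add0x A Z (x : Z ~> A) : add (zeroAt Z A) x = x.
Proof. exact: cm_1 (do_monoid A) _ _. Qed.

Lemma addx0 A Z (x : Z ~> A) : add x (zeroAt Z A) = x.
Proof. by rewrite addC add0x. Qed.

Lemma comp_add A Y Z (h : Y ~> Z) (x y : Z ~> A) :
  h \; add x y = add (h \; x) (h \; y).
Proof. by rewrite /add compA comp_pair. Qed.

Lemma comp_zero A Y Z (h : Y ~> Z) : h \; zeroAt Z A = zeroAt Y A.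
Proof. by rewrite /zeroAt compA; congr (_ \; _); exact: one_eq. Qed.

(** [T A] is the product of [A], the base point, with [A], the vector. *)
Definition do_proj_lim A : product_lim (tproj A) (phat A) := do_lim A.

(** The tangent vector [v] at the point [x]. *)
Definition tvec A Z (x v : Z ~> A) : Z ~> T A := pl_pair (do_proj_lim A) x v.

Lemma tvec_p A Z (x v : Z ~> A) : tvec x v \; tproj A = x.
Proof. exact: pl_pair1. Qed.

Lemma tvec_phat A Z (x v : Z ~> A) : tvec x v \; phat A = v.
Proof. exact: pl_pair2. Qed.

Lemma TA_eq A Z (h k : Z ~> T A) :
  h \; tproj A = k \; tproj A -> h \; phat A = k \; phat A -> h = k.
Proof. exact: pl_unique (do_proj_lim A) _ _ _. Qed.

Lemma TTA_eq A Z (h k : Z ~> T (T A)) :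
  h \; fmap T (tproj A) = k \; fmap T (tproj A) ->
  h \; fmap T (phat A) = k \; fmap T (phat A) -> h = k.
Proof. exact: pl_unique (T_product (do_proj_lim A)) _ _ _. Qed.

Lemma comp_tvec A Y Z (h : Y ~> Z) (x v : Z ~> A) :
  h \; tvec x v = tvec (h \; x) (h \; v).
Proof. by apply: TA_eq; rewrite -compA ?tvec_p ?tvec_phat. Qed.

Lemma tvec_eta A Z (h : Z ~> T A) : tvec (h \; tproj A) (h \; phat A) = h.
Proof. by apply: TA_eq; rewrite ?tvec_p ?tvec_phat. Qed.

Lemma do_joinE A Z (x v : Z ~> A) : ⟨x, v⟩ \; do_join A = tvec x v.
Proof.
by apply: TA_eq; rewrite -compA ?pl_pair1 ?pl_pair2 ?pairm1 ?pairm2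
  ?tvec_p ?tvec_phat.
Qed.

Lemma do_join_p A : do_join A \; tproj A = prd1 A A.
Proof. exact: pl_pair1. Qed.

Lemma do_join_phat A : do_join A \; phat A = prd2 A A.
Proof. exact: pl_pair2. Qed.

Lemma tzero_phat A : tzero A \; phat A = zeroAt A A.
Proof. exact: do_zeroT. Qed.

Lemma tzeroE A Z (x : Z ~> A) : x \; tzero A = tvec x (zeroAt Z A).
Proof.
by apply: TA_eq; rewrite -compA ?tvec_p ?tvec_phat ?tzero_proj ?compm1 //
  tzero_phat comp_zero.
Qed.

Lemma tlift_phat A : tlift A \; fmap T (phat A) = tvec (zeroAt _ A) (phat A).
Proof.
apply: TA_eq; last by rewrite tvec_phat -compA do_ell.
by rewrite tvec_p -compA tprojN compA tlift_proj -compA tzero_phat comp_zero.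
Qed.

(** The element of [T (T A)] with coordinates [x] along p p, [v] along T(p^) p,
    [w] along T(p) p^ and [t] along T(p^) p^, where p^ is [phat]. *)
Definition ttvec A Z (x v w t : Z ~> A) : Z ~> T (T A) :=
  pl_pair (T_product (do_proj_lim A)) (tvec x w) (tvec v t).

Lemma ttvec_Tp A Z (x v w t : Z ~> A) :
  ttvec x v w t \; fmap T (tproj A) = tvec x w.
Proof. exact: pl_pair1. Qed.

Lemma ttvec_Tphat A Z (x v w t : Z ~> A) :
  ttvec x v w t \; fmap T (phat A) = tvec v t.
Proof. exact: pl_pair2. Qed.

(** The addition of [T A] that comes from the monoid structure of [A]; it adds
    base points and vectors, unlike the fibrewise addition [plusT]. *)
Definition Tadd A Z (x y : Z ~> T A) : Z ~> T A :=
  pl_pair (T_prd_lim A A) x y \; fmap T (sigma A).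

Lemma comp_Tadd A Y Z (h : Y ~> Z) (x y : Z ~> T A) :
  h \; Tadd x y = Tadd (h \; x) (h \; y).
Proof.
rewrite /Tadd compA; congr (_ \; _).
by apply: (pl_unique (T_prd_lim A A)); rewrite -compA ?pl_pair1 ?pl_pair2.
Qed.

Lemma Tadd_pair A Z (x y : Z ~> A) :
  fmap T ⟨x, y⟩ \; fmap T (sigma A) = Tadd (fmap T x) (fmap T y).
Proof.
rewrite /Tadd; congr (_ \; _).
by apply: (pl_unique (T_prd_lim A A));
  rewrite -?fmapM ?pairm1 ?pairm2 ?pl_pair1 ?pl_pair2.
Qed.

Lemma Tadd_p A Z (x y : Z ~> T A) : Tadd x y \; tproj A
  = add (x \; tproj A) (y \; tproj A).
Proof.
rewrite /Tadd -compA tprojN compA /add; congr (_ \; _); apply: prd_eq;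
 by rewrite -compA -tprojN compA ?pairm1 ?pairm2 ?pl_pair1 ?pl_pair2.
Qed.

Lemma Tsigma_phat A Z (h : Z ~> T (A ** A)) :
  h \; fmap T (sigma A) \; phat A
  = add (h \; fmap T (prd1 A A) \; phat A) (h \; fmap T (prd2 A A) \; phat A).
Proof. by rewrite do_Tsigma (compA (Tsplit A A)) TsplitE !compA comp_pair
  !compA. Qed.

Lemma Tadd_phat A Z (x y : Z ~> T A) :
  Tadd x y \; phat A = add (x \; phat A) (y \; phat A).
Proof.
by rewrite /Tadd -compA Tsigma_phat !compA pl_pair1 pl_pair2.
Qed.

(** The addition of [T (T A)] that comes from the monoid structure of [A]. *)
Definition TTadd A Z (x y : Z ~> T (T A)) : Z ~> T (T A) :=
  pl_pair (T_product (T_prd_lim A A)) x y \; fmap T (fmap T (sigma A)).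

Lemma TTadd_flip A Z (x y : Z ~> T (T A)) :
  TTadd x y \; tflip A = TTadd (x \; tflip A) (y \; tflip A).
Proof.
rewrite /TTadd -compA -tflipN compA; congr (_ \; _).
apply: (pl_unique (T_product (T_prd_lim A A)));
  by rewrite -!compA tflipN ?compA ?pl_pair1 ?pl_pair2.
Qed.

Lemma TTadd_Tp A Z (x y : Z ~> T (T A)) :
  TTadd x y \; fmap T (tproj A)
    = Tadd (x \; fmap T (tproj A)) (y \; fmap T (tproj A)).
Proof.
rewrite /TTadd -compA -fmapM tprojN fmapM compA; congr (_ \; _).
by apply: (pl_unique (T_prd_lim A A));
  rewrite -compA -fmapM -tprojN fmapM compA ?pl_pair1 ?pl_pair2.
Qed.

Lemma TTadd_Tphat A Z (x y : Z ~> T (T A)) :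
  TTadd x y \; fmap T (phat A)
  = Tadd (x \; fmap T (phat A)) (y \; fmap T (phat A)).
Proof.
rewrite /TTadd -compA -fmapM.
have -> : fmap T (sigma A) \; phat A
   = add (fmap T (prd1 A A) \; phat A) (fmap T (prd2 A A) \; phat A).
  by have := Tsigma_phat (idm (T (A ** A))); rewrite !comp1m.
rewrite /add fmapM compA; congr (_ \; _).
by apply: (pl_unique (T_prd_lim A A));
  rewrite -compA -fmapM ?pairm1 ?pairm2 fmapM compA ?pl_pair1 ?pl_pair2.
Qed.

Lemma Tadd_tvec A Z (x v y w : Z ~> A) :
  Tadd (tvec x v) (tvec y w) = tvec (add x y) (add v w).
Proof. by apply: TA_eq; rewrite ?Tadd_p ?Tadd_phat ?tvec_p ?tvec_phat. Qed.

Lemma TTadd_ttvec A Z (x v w t x' v' w' t' : Z ~> A) :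
  TTadd (ttvec x v w t) (ttvec x' v' w' t')
  = ttvec (add x x') (add v v') (add w w') (add t t').
Proof.
by apply: TTA_eq; rewrite ?TTadd_Tp ?TTadd_Tphat ?ttvec_Tp
  ?ttvec_Tphat Tadd_tvec.
Qed.

Lemma Ttzero_phat A : fmap T (tzero A) \; fmap T (phat A) = zeroAt _ A \;
  tzero A.
Proof.
rewrite -fmapM tzero_phat /zeroAt fmapM; apply: TA_eq.
  rewrite -!compA tprojN tzero_proj compm1 compA; congr (_ \; _); exact: one_eq.
rewrite -!compA tzero_phat do_Tzeta /zeroAt !compA; congr (_ \; _).
exact: one_eq.
Qed.

Lemma tzero_ttvec A Z (x v : Z ~> A) :
  tvec x v \; tzero (T A) = ttvec x v (zeroAt Z A) (zeroAt Z A).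
Proof.
by apply: TTA_eq; rewrite ?ttvec_Tp ?ttvec_Tphat -compA tzeroN compA
  ?tvec_p ?tvec_phat tzeroE.
Qed.

Lemma Ttzero_ttvec A Z (x w : Z ~> A) :
  tvec x w \; fmap T (tzero A) = ttvec x (zeroAt Z A) w (zeroAt Z A).
Proof.
apply: TTA_eq; rewrite ?ttvec_Tp ?ttvec_Tphat -compA.
  by rewrite -fmapM tzero_proj fmap1 compm1.
by rewrite Ttzero_phat compA comp_zero tzeroE.
Qed.

Lemma tlift_ttvec A Z (x t : Z ~> A) :
  tvec x t \; tlift A = ttvec x (zeroAt Z A) (zeroAt Z A) t.
Proof.
apply: TTA_eq; rewrite ?ttvec_Tp ?ttvec_Tphat -compA.
  by rewrite tlift_Tproj compA tvec_p tzeroE.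
by rewrite tlift_phat comp_tvec comp_zero tvec_phat.
Qed.

(** The canonical flip exchanges the two middle coordinates. Its effect on the
    last coordinate is not among the axioms. An element is the [TTadd] sum of a
    zero vector, the image under [T] of a zero vector, and a vertical lift; the
    flip respects this sum by naturality and is known on each summand. *)
Lemma ttvec_flip A Z (x v w t : Z ~> A) :
  ttvec x v w t \; tflip A = ttvec x w v t.
Proof.
have -> : ttvec x v w t =
  TTadd (tvec x v \; tzero (T A))
    (TTadd (tvec (zeroAt Z A) w \; fmap T (tzero A))
           (tvec (zeroAt Z A) t \; tlift A)).
  by rewrite tzero_ttvec Ttzero_ttvec tlift_ttvec !TTadd_ttvec !(add0x, addx0).
rewrite !TTadd_flip -!compA tzero_flip Ttzero_flip tlift_flip.
by rewrite tzero_ttvec Ttzero_ttvec tlift_ttvec !TTadd_ttvec !(add0x, addx0).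
Qed.

End DiffObj.

(** * Differential calculus on differential objects *)

(* Products of differential objects are inferred from their carriers. *)
#[local] Canonical do_prd.

Section Derivative.
Context (X : cartesian_tangent_category).
Implicit Types A B E Y : diffobj X.
Implicit Types Z : X.

(** The derivative of [f] at the point [x] along the vector [v]. *)
Definition Dat A B (f : A ~> B) Z (x v : Z ~> A) : Z ~> B := ⟨x, v⟩ \; D f.

Lemma DatE A B (f : A ~> B) Z (x v : Z ~> A) :
  Dat f x v = tvec x v \; fmap T f \; phat B.
Proof. by rewrite /Dat /D !compA do_joinE. Qed.

Lemma tvec_T A B (f : A ~> B) Z (x v : Z ~> A) :
  tvec x v \; fmap T f = tvec (x \; f) (Dat f x v).
Proof.
apply: TA_eq; first by rewrite -compA tprojN compA !tvec_p.
by rewrite tvec_phat DatE compA.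
Qed.

Lemma comp_Dat A B (f : A ~> B) (W Z : X) (h : W ~> Z) (x v : Z ~> A) :
  h \; Dat f x v = Dat f (h \; x) (h \; v).
Proof. by rewrite /Dat compA comp_pair. Qed.

Lemma Dat_comp A B E (f : A ~> B) (g : B ~> E) Z (x v : Z ~> A) :
  Dat (f \; g) x v = Dat g (x \; f) (Dat f x v).
Proof. by rewrite DatE fmapM !compA tvec_T -compA -DatE. Qed.

Lemma Dat_id A Z (x v : Z ~> A) : Dat (idm A) x v = v.
Proof. by rewrite DatE fmap1 comp1m tvec_phat. Qed.

Lemma Dat0 A B (f : A ~> B) Z (x : Z ~> A) : Dat f x (zeroAt Z A) = zeroAt Z B.
Proof.
by rewrite DatE -tzeroE !compA -(compA x) tzeroN compA -compA
  tzero_phat comp_zero.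
Qed.

Lemma Dat_const A B (b : one ~> B) Z (x v : Z ~> A) :
  Dat (bang A \; b) x v = zeroAt Z B.
Proof.
rewrite DatE fmapM !compA.
have -> : tvec x v \; fmap T (bang A) = bang Z \; tzero one.
  exact: tl_unique (T_one_lim X) _ _ _.
by rewrite -(compA (bang Z)) tzeroN compA -compA tzero_phat comp_zero.
Qed.

Lemma tvec_Tprd1 A B Z (x v : Z ~> A ** B) :
  tvec x v \; fmap T (prd1 A B) = tvec (x \; prd1 A B) (v \; prd1 A B).
Proof.
apply: TA_eq; first by rewrite -compA tprojN compA !tvec_p.
by rewrite tvec_phat -dp_phat1 tvec_phat.
Qed.

Lemma tvec_Tprd2 A B Z (x v : Z ~> A ** B) :
  tvec x v \; fmap T (prd2 A B) = tvec (x \; prd2 A B) (v \; prd2 A B).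
Proof.
apply: TA_eq; first by rewrite -compA tprojN compA !tvec_p.
by rewrite tvec_phat -dp_phat2 tvec_phat.
Qed.

Lemma Dat_prd1 A B Z (x v : Z ~> A ** B) : Dat (prd1 A B) x v = v \; prd1 A B.
Proof. by rewrite DatE compA tvec_Tprd1 tvec_phat. Qed.

Lemma Dat_prd2 A B Z (x v : Z ~> A ** B) : Dat (prd2 A B) x v = v \; prd2 A B.
Proof. by rewrite DatE compA tvec_Tprd2 tvec_phat. Qed.

Lemma Dat_pair A B E (f : A ~> B) (g : A ~> E) Z (x v : Z ~> A) :
  Dat ⟨f, g⟩ x v = ⟨Dat f x v, Dat g x v⟩.
Proof.
apply: prd_eq; rewrite ?pairm1 ?pairm2.
  by rewrite -[f in RHS](pairm1 f g) Dat_comp Dat_prd1.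
by rewrite -[g in RHS](pairm2 f g) Dat_comp Dat_prd2.
Qed.

Lemma Dat_sigma A Z (x v : Z ~> A ** A) : Dat (sigma A) x v = v \; sigma A.
Proof.
rewrite DatE Tsigma_phat !compA tvec_Tprd1 tvec_Tprd2 !tvec_phat /add
  -comp_pair.
by congr (_ \; _); apply: prd_eq; rewrite -compA ?pairm1 ?pairm2.
Qed.

Lemma Dat_DE A B (f : A ~> B) Z (x v w t : Z ~> A) :
  Dat (D f) ⟨x, v⟩ ⟨w, t⟩
  = ttvec x v w t \; fmap T (fmap T f) \; fmap T (phat B) \; phat B.
Proof.
rewrite DatE /D !fmapM !compA; do 3 congr (_ \; _).
apply: TTA_eq; rewrite -compA -fmapM ?do_join_p ?do_join_phat.
  by rewrite tvec_Tprd1 !pairm1 ttvec_Tp.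
by rewrite tvec_Tprd2 !pairm2 ttvec_Tphat.
Qed.

(** Symmetry of second derivatives, from naturality of the canonical flip. *)
Lemma Dat_D_sym A B (f : A ~> B) Z (x v w t : Z ~> A) :
  Dat (D f) ⟨x, v⟩ ⟨w, t⟩ = Dat (D f) ⟨x, w⟩ ⟨v, t⟩.
Proof.
have E (h : Z ~> T (T B)) :
    h \; tflip B \; fmap T (phat B) \; phat B = h \; fmap T (phat B) \; phat B.
  pose x' := h \; tproj (T B) \; tproj B; pose v' := h \; tproj (T B) \; phat B.
  pose w' := h \; fmap T (tproj B) \; phat B.
  pose t' := h \; fmap T (phat B) \; phat B.
  have -> : h = ttvec x' v' w' t'.
    apply: TTA_eq; apply: TA_eq;
    by rewrite ?ttvec_Tp ?ttvec_Tphat ?tvec_p ?tvec_phat -?compA ?tprojN.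
  rewrite !compA ttvec_flip !ttvec_Tphat.
  by rewrite !tvec_phat.
rewrite !Dat_DE -[ttvec x v w t](ttvec_flip x w v t) -!compA.
by rewrite (compA (tflip A)) tflipN -!compA compA E !compA.
Qed.

(** The vector part of [T f] is additive in each fibre. *)
Lemma plusT_T A B (f : A ~> B) :
  plusT A \; fmap T f \; phat B
  = add (fp0 (Tpow 2 A) \; fmap T f \; phat B)
        (fp1 (Tpow 2 A) \; fmap T f \; phat B).
Proof.
by rewrite compA plusTN -compA do_plusT compA comp_pair !compA
  fp_pair0 fp_pair1.
Qed.

(** The pairing into [T (T_2 M)] of two elements over the same base, for the
    additive bundle T(p). *)
Definition Tpair2 (M Z : X) (h k : Z ~> T (T M))
    (H : h \; fmap T (tproj M) = k \; fmap T (tproj M)) : Z ~> T (Tpow 2 M) :=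
  fp_pair (fp_tangent (Tpow 2 M)) H.

Lemma Tpair2_0 (M Z : X) (h k : Z ~> T (T M))
    (H : h \; fmap T (tproj M) = k \; fmap T (tproj M)) :
  Tpair2 H \; fmap T (fp0 (Tpow 2 M)) = h.
Proof. exact: (fp_pair0 (fp_tangent (Tpow 2 M)) H). Qed.

Lemma Tpair2_1 (M Z : X) (h k : Z ~> T (T M))
    (H : h \; fmap T (tproj M) = k \; fmap T (tproj M)) :
  Tpair2 H \; fmap T (fp1 (Tpow 2 M)) = k.
Proof. exact: (fp_pair1 (fp_tangent (Tpow 2 M)) H). Qed.

(** The sum of a zero vector and a vertical lift for the additive bundle T(p). *)
Lemma ttvec_add A Z (x v t : Z ~> A)
    (H : (tvec x v \; tzero (T A)) \; fmap T (tproj A)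
       = (tvec x t \; tlift A) \; fmap T (tproj A)) :
  Tpair2 H \; fmap T (plusT A)
  = ttvec x v (zeroAt Z A) t.
Proof.
apply: TTA_eq; rewrite ?ttvec_Tp ?ttvec_Tphat -compA -fmapM.
- rewrite [plusT A \; tproj A](ab_addq (tc_additive A)).
  rewrite -[fp_base _](fp_comm (fp_limit (Tpow 2 A)) ord0) fmapM compA.
  by rewrite Tpair2_0 tzero_ttvec ttvec_Tp.
rewrite do_plusT -/(add _ _).
have -> : fmap T (add (fp0 (Tpow 2 A) \; phat A) (fp1 (Tpow 2 A) \; phat A))
  = Tadd (fmap T (fp0 (Tpow 2 A) \; phat A))
         (fmap T (fp1 (Tpow 2 A) \; phat A)).
  by rewrite /add fmapM Tadd_pair.
rewrite comp_Tadd !fmapM !compA.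
rewrite Tpair2_0 Tpair2_1.
by rewrite tzero_ttvec tlift_ttvec !ttvec_Tphat Tadd_tvec addx0 add0x.
Qed.

(** The derivative is linear in the vector: differentiating [D f] at [(x, v)] in
    the direction [(0, t)] gives the derivative of [f] at [x] along [t]. By
    [ttvec_add], the second tangent vector concerned is a sum that
    [fmap T (fmap T f)] preserves, and whose parts are handled by naturality. *)
Lemma Dat_D_lin A B (f : A ~> B) Z (x v t : Z ~> A) :
  Dat (D f) ⟨x, v⟩ ⟨zeroAt Z A, t⟩ = Dat f x t.
Proof.
have H : (tvec x v \; tzero (T A)) \; fmap T (tproj A)
       = (tvec x t \; tlift A) \; fmap T (tproj A).
  by rewrite tzero_ttvec tlift_ttvec !ttvec_Tp.
rewrite Dat_DE -(ttvec_add H).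
have -> : (Tpair2 H \; fmap T (plusT A))
    \; fmap T (fmap T f) \; fmap T (phat B) \; phat B
  = Tpair2 H
    \; fmap T (plusT A \; fmap T f \; phat B) \; phat B.
  by rewrite !fmapM !compA.
rewrite plusT_T /add fmapM Tadd_pair (compA (Tpair2 H)) comp_Tadd Tadd_phat
  !fmapM !compA.
rewrite Tpair2_0 Tpair2_1.
rewrite -(compA _ (tzero (T A))) tzeroN -(compA _ (tlift A)) tliftN !compA.
rewrite -(compA _ (tzero (T B))) tzeroN !compA -(compA _ (tzero B))
  tzero_phat comp_zero.
rewrite add0x -(compA _ (tlift B)) tlift_phat comp_tvec tvec_phat.
by rewrite -compA -DatE.
Qed.

Lemma prd_eta (A B : X) : ⟨prd1 A B, prd2 A B⟩ = idm (A ** B).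
Proof. by apply: prd_eq; rewrite comp1m ?pairm1 ?pairm2. Qed.

Lemma tvec_Tjoin A B Z (x v : Z ~> A) (y w : Z ~> B) :
  ⟨tvec x v, tvec y w⟩ \; Tjoin A B = tvec ⟨x, y⟩ ⟨v, w⟩.
Proof.
by apply: (pl_unique (T_prd_lim A B));
  rewrite -compA ?pl_pair1 ?pl_pair2 ?tvec_Tprd1 ?tvec_Tprd2 ?pairm1 ?pairm2.
Qed.

Lemma zero_pair A Y Z : ⟨zeroAt Z A, zeroAt Z Y⟩ = zeroAt Z (do_prd A Y).
Proof.
by apply: prd_eq; rewrite ?pairm1 ?pairm2 /zeroAt -?compA ?pairm1 ?pairm2.
Qed.

(** [F] is linear in its first argument: its partial derivative in that argument
    along [a], at any point, is its value at [a]. *)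
Definition lin1 A Y B (F : A ** Y ~> B) :=
  forall Z (x a : Z ~> A) (y : Z ~> Y),
  Dat F ⟨x, y⟩ ⟨a, zeroAt Z Y⟩ = ⟨a, y⟩ \; F.

Lemma lin1_zero A Y B (F : A ** Y ~> B) Z (y : Z ~> Y) :
  lin1 F -> ⟨zeroAt Z A, y⟩ \; F = zeroAt Z B.
Proof.
move=> linF; rewrite -(linF Z (zeroAt Z A)).
by rewrite zero_pair; exact: Dat0.
Qed.

End Derivative.

(** * A differential object as a differential bundle over the terminal object *)

Section BundleOverOne.
Context (X : cartesian_tangent_category) (A : diffobj X).
Implicit Types Z : X.

(** The addition of [A], on the fibre power of the bundle. *)
Definition do_badd : npow_fp A 2 ~> A :=
  add (fp0 (npow_fp A 2)) (fp1 (npow_fp A 2)).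

(** The bundle [A -> 1]; its fibre powers are the powers of [A]. *)
Definition do_bundle : bundle T A one :=
  @Bundle X T A one (bang A) (fun n => npow_fp A n) do_badd (zeta A).

Lemma do_baddE Z (x y : Z ~> A) (H : x \; bang A = y \; bang A) :
  fp_pair (npow_fp A 2) H \; do_badd = add x y.
Proof. by rewrite comp_add fp_pair0 fp_pair1. Qed.

Lemma do_TbaddE Z (x y : Z ~> T A)
    (H : x \; fmap T (bang A) = y \; fmap T (bang A)) :
  fp_pair (fp_tangent (npow_fp A 2)) H \; fmap T do_badd = Tadd x y.
Proof.
rewrite /do_badd /add fmapM Tadd_pair comp_Tadd.
congr (Tadd _ _).
  exact: (fp_pair0 (fp_tangent (npow_fp A 2)) H).
exact: (fp_pair1 (fp_tangent (npow_fp A 2)) H).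
Qed.

Lemma do_bundle_additive : additive_bundle do_bundle.
Proof.
split; try by move=> *; exact: one_eq.
- by move=> Z x y xy yx; rewrite !do_baddE addC.
- move=> Z x y z xy yz xy_z x_yz; rewrite !do_baddE.
  exact: (cm_A (do_monoid A)).
- move=> Z x H; rewrite do_baddE.
  rewrite -[RHS]add0x; congr (add _ _).
  by rewrite compA; congr (_ \; _); exact: one_eq.
Qed.

Lemma zetaE : zeta A = zeroAt one A.
Proof. by rewrite /zeroAt -[LHS]comp1m; congr (_ \; _); exact: one_eq. Qed.

Lemma do_liftE Z (x : Z ~> A) : x \; do_lift A = tvec (zeroAt Z A) x.
Proof.
by rewrite -[do_lift A]/(tvec (zeroAt A A) (idm A)) comp_tvec comp_zero compm1.
Qed.

(** The lift as an additive morphism for the additive structure T(q). *)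
Lemma do_lift_T :
  additive_morphism do_bundle (bundle_tangent do_bundle) (do_lift A)
    (zeroT one).
Proof.
have sq : do_lift A \; bq (bundle_tangent do_bundle)
    = bq do_bundle \; zeroT one.
  exact: tl_unique (T_one_lim X) _ _ _.
apply: (@AdditiveMorphism _ _ _ _ _ _ _ _ _ _ sq).
- rewrite do_TbaddE !do_liftE Tadd_tvec add0x.
  by rewrite -[badd _]/do_badd.
- rewrite do_liftE /= -/(tzero one) tzeroN tzeroE zetaE //.
Qed.

(** The lift as an additive morphism for the additive structure of the tangent
    bundle. *)
Lemma do_lift_p :
  additive_morphism do_bundle (tbundle A) (do_lift A) (bzero do_bundle).
Proof.
have sq : do_lift A \; bq (tbundle A) = bq do_bundle \; bzero do_bundle.
  exact: (tvec_p (zeroAt A A) (idm A)).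
apply: (@AdditiveMorphism _ _ _ _ _ _ _ _ _ _ sq).
- have pE (P : fibre_power T 2 (p A)) : fp_base P = fp0 P \; tproj A.
    by rewrite -(fp_comm (fp_limit P) ord0).
  rewrite do_liftE; apply: TA_eq.
    rewrite tvec_p -compA [badd _ \; tproj A](ab_addq (tc_additive A)) pE.
    rewrite compA [fp_map _ _ _ \; fp0 _]fp_pair0 -compA tvec_p comp_zero //.
  rewrite tvec_phat -compA [badd _ \; phat A]do_plusT compA comp_pair !compA.
  rewrite [fp_map _ _ _ \; fp0 _]fp_pair0 [fp_map _ _ _ \; fp1 _]fp_pair1.
  by rewrite -!compA tvec_phat !compm1.
- by rewrite do_liftE /= -/(tzero A) tzeroE zetaE.
Qed.

Lemma do_lift_ell : do_lift A \; ell A = do_lift A \; fmap T (do_lift A).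
Proof.
rewrite -/(tlift A) -[LHS]comp1m compA do_liftE tlift_ttvec; apply: TTA_eq.
  rewrite ttvec_Tp -compA -fmapM.
  rewrite -[do_lift A]/(tvec (zeroAt A A) (idm A)).
  by rewrite tvec_p tvec_T comp_zero /zeroAt Dat_const.
rewrite ttvec_Tphat -compA -fmapM.
rewrite -[do_lift A]/(tvec (zeroAt A A) (idm A)).
by rewrite tvec_phat fmap1 compm1.
Qed.

(** The map [db_mu] is invertible: it sends a pair to the tangent vector with
    these coordinates. *)
Lemma do_bundle_pullback :
  stable_pullback T (fmap T (bq do_bundle)) (zeroT one)
    (db_mu (am_sq do_lift_T)) (fp0 (bpow do_bundle 2) \; bq do_bundle).
Proof.
have H : tproj A \; bang A = phat A \; bang A by exact: one_eq.
have muE : db_mu (am_sq do_lift_T)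
    = tvec (fp0 (npow_fp A 2)) (fp1 (npow_fp A 2)).
  rewrite /db_mu do_TbaddE -/(tzero A) tzeroE do_liftE Tadd_tvec.
  by rewrite addx0 add0x.
apply: (@iso_stable_pullback _ _ _ _ _ _ _ _ _ (fp_pair (npow_fp A 2) H)).
- exact: one_lim.
- exact: T_one_lim.
- rewrite muE; apply: fp2_unique; rewrite comp1m -compA.
    by rewrite fp_pair0 tvec_p.
  by rewrite fp_pair1 tvec_phat.
- by rewrite muE comp_tvec fp_pair0 fp_pair1 -[RHS]tvec_eta !comp1m.
Qed.

(** The differential bundle over the terminal object given by [A]. *)
Definition do_diff_bundle : differential_bundle A one :=
  DifferentialBundle do_bundle_additive do_lift_p do_lift_ell
    do_bundle_pullback.

(** In the coordinates of the second tangent object, both sides of the linearity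
    equation are [(0, 0, 1, 1)]. *)
Lemma Delta_linear : linear_vector_field do_diff_bundle (Delta A) (zeroT one).
Proof.
have DeltaE : Delta A = tvec (idm A) (idm A) by [].
have liftE : do_lift A = tvec (zeroAt A A) (idm A) by [].
have E1 : do_lift A \; fmap T (Delta A)
    = ttvec (zeroAt A A) (zeroAt A A) (idm A) (idm A).
  apply: TTA_eq; rewrite ?ttvec_Tp ?ttvec_Tphat -compA -fmapM DeltaE.
    by rewrite tvec_p fmap1 compm1.
  by rewrite tvec_phat fmap1 compm1.
have E2 : Delta A \; fmap T (do_lift A)
    = ttvec (zeroAt A A) (idm A) (zeroAt A A) (idm A).
  apply: TTA_eq; rewrite ?ttvec_Tp ?ttvec_Tphat -compA -fmapM liftE.
    by rewrite tvec_p DeltaE tvec_T /zeroAt Dat_const comp1m.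
  by rewrite tvec_phat fmap1 compm1.
split.
- exact: (tvec_p (idm A) (idm A)).
- exact: tzero_proj.
- exact: tl_unique (T_one_lim X) _ _ _.
- by rewrite /= E1 compA E2 ttvec_flip.
Qed.

End BundleOverOne.

(** * Systems on a differential curve object and the exponential *)

Section Exponential.
Context (X : cartesian_tangent_category) (C : diff_curve_object X).
Implicit Types A B E Y : diffobj X.
Implicit Types Z : X.

Notation u := (dco_u C).
Notation c0 := (dco_c0 C).
Notation c1 := (dco_c1 C).

(** The unit of the curve object, at an arbitrary stage of definition. *)
Definition uAt Z : Z ~> C := bang Z \; u.

Lemma comp_uAt (W Z : X) (h : W ~> Z) : h \; uAt Z = uAt W.
Proof. by rewrite /uAt compA; congr (_ \; _); exact: one_eq. Qed.

Lemma c1E : c1 = tvec (idm C) (uAt C).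
Proof.
apply: TA_eq; rewrite ?tvec_p ?tvec_phat.
  exact: co_vector_field (dco_curve C).
by rewrite dco_unit.
Qed.

Lemma c0E Z : bang Z \; c0 = zeroAt Z C.
Proof. by rewrite dco_zeta. Qed.

(** In coordinates, time flows along [u] and the parameter is constant. *)
Lemma clock_fieldE Y :
  (c1 ⊗ zeroT Y) \; Tjoin C Y
  = tvec (idm (C ** Y)) ⟨uAt (C ** Y), zeroAt (C ** Y) Y⟩.
Proof.
by rewrite /prd_map c1E -/(tzero Y) comp_tvec compm1 comp_uAt tzeroE
  tvec_Tjoin prd_eta.
Qed.

(** When the state space and the parameters are differential objects, a system
    is an initial value problem; [V] is the vector part of the vector field. *)
Lemma solutionP A Y (V : A ~> A) (g : Y ~> A) (gam : C ** Y ~> A) :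
  solution c1 c0 (tvec (idm A) V) g gam <->
  ⟨zeroAt Y C, idm Y⟩ \; gam = g /\
  Dat gam (idm (C ** Y)) ⟨uAt (C ** Y), zeroAt (C ** Y) Y⟩ = gam \; V.
Proof.
rewrite /solution c0E compA clock_fieldE tvec_T comp_tvec comp1m compm1.
split=> -[-> H]; split=> //; last by rewrite H.
by rewrite -[LHS](tvec_phat gam) H tvec_phat.
Qed.

Lemma system_unique A Y (V : A ~> A) (gam gam' : C ** Y ~> A) :
  ⟨zeroAt Y C, idm Y⟩ \; gam = ⟨zeroAt Y C, idm Y⟩ \; gam' ->
  Dat gam (idm (C ** Y)) ⟨uAt (C ** Y), zeroAt (C ** Y) Y⟩ = gam \; V ->
  Dat gam' (idm (C ** Y)) ⟨uAt (C ** Y), zeroAt (C ** Y) Y⟩ = gam' \; V ->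
  gam = gam'.
Proof.
move=> H0 H H'; apply: (co_unique (dco_curve C)).
- exact: (tvec_p (idm A) V).
- by apply/solutionP; split; [exact: erefl | exact: H].
- by apply/solutionP; split; [rewrite -H0 | exact: H'].
Qed.

(** A map that is linear in its first argument is determined by its restriction
    to [u]. *)
Lemma lin1_unique Y (F G : C ** Y ~> C) :
  lin1 F -> lin1 G -> ⟨uAt Y, idm Y⟩ \; F = ⟨uAt Y, idm Y⟩ \; G -> F = G.
Proof.
move=> linF linG H.
suff: ⟨F, prd2 C Y⟩ = ⟨G, prd2 C Y⟩.
  by move/(congr1 (fun h => h \; prd1 C Y)); rewrite !pairm1.
(* The parameter [y] is made part of the state, so that the vector part of
   the field at [(a, y)], namely [(F (u, y), 0)], may depend on it. *)
pose V : C ** Y ~> C ** Y :=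
  ⟨prd2 C Y \; ⟨uAt Y, idm Y⟩ \; F, zeroAt (C ** Y) Y⟩.
have sol (K : C ** Y ~> C) : lin1 K ->
    ⟨uAt Y, idm Y⟩ \; F = ⟨uAt Y, idm Y⟩ \; K ->
  Dat ⟨K, prd2 C Y⟩ (idm (C ** Y)) ⟨uAt (C ** Y), zeroAt (C ** Y) Y⟩
  = ⟨K, prd2 C Y⟩ \; V.
  move=> linK EK; rewrite Dat_pair Dat_prd2 pairm2 -prd_eta linK /V
    comp_pair comp_zero.
  congr ⟨_, _⟩.
  by rewrite compA pairm2 EK compA comp_pair comp_uAt compm1.
apply: (@system_unique (do_prd C Y) Y V); last 2 first.
- exact: sol.
- exact: sol.
rewrite !comp_pair; congr ⟨_, _⟩.
by rewrite !lin1_zero.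
Qed.

(** Both sides of the associative law are linear in the first factor and agree
    when it is [u]. *)
Lemma lin1_assoc (m : C ** C ~> C) :
  lin1 m -> (forall Z (x : Z ~> C), ⟨uAt Z, x⟩ \; m = x) ->
  forall Z (x y z : Z ~> C),
  ⟨⟨x, y⟩ \; m, z⟩ \; m = ⟨x, ⟨y, z⟩ \; m⟩ \; m.
Proof.
move=> m_lin m_u Z x y z.
pose x0 := prd1 C (C ** C); pose yz := prd2 C (C ** C).
pose y0 := yz \; prd1 C C; pose z0 := yz \; prd2 C C.
pose F := ⟨⟨x0, y0⟩ \; m, z0⟩ \; m.
pose G := ⟨x0, yz \; m⟩ \; m.
have FE W (h : W ~> C ** (C ** C)) :
  h \; F = ⟨⟨h \; x0, h \; y0⟩ \; m, h \; z0⟩ \; m.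
  by rewrite /F compA comp_pair compA comp_pair.
have GE W (h : W ~> C ** (C ** C)) :
  h \; G = ⟨h \; x0, (h \; yz) \; m⟩ \; m.
  by rewrite /G compA comp_pair compA.
suff E : F = G.
  have := congr1 (fun K => ⟨x, ⟨y, z⟩⟩ \; K) E.
  rewrite FE GE /y0 /z0 !compA /x0 /yz !(pairm1, pairm2).
  by [].
apply: (@lin1_unique (do_prd C C)).
- move=> W b a c.
  have y0E : Dat y0 ⟨b, c⟩ ⟨a, zeroAt W (do_prd C C)⟩ = zeroAt W C.
    by rewrite /y0 /yz Dat_comp Dat_prd1 Dat_prd2 pairm2
      -(zero_pair C C) pairm1.
  have z0E : Dat z0 ⟨b, c⟩ ⟨a, zeroAt W (do_prd C C)⟩ = zeroAt W C.
    by rewrite /z0 /yz Dat_comp !Dat_prd2 pairm2 -(zero_pair C C) pairm2.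
  have yE (h : W ~> C) : ⟨h, c⟩ \; y0 = c \; prd1 C C.
    by rewrite /y0 /yz compA pairm2.
  have zE (h : W ~> C) : ⟨h, c⟩ \; z0 = c \; prd2 C C.
    by rewrite /z0 /yz compA pairm2.
  rewrite FE /F Dat_comp Dat_pair Dat_comp Dat_pair y0E z0E Dat_prd1 pairm1.
  by rewrite comp_pair (compA _ ⟨x0, y0⟩) !comp_pair !yE !zE !m_lin /x0 !pairm1.
- move=> W b a c.
  rewrite GE /G Dat_comp Dat_pair Dat_comp Dat_prd1 Dat_prd2 pairm1 pairm2 Dat0.
  by rewrite comp_pair m_lin !compA /x0 /yz !(pairm1, pairm2).
rewrite FE GE /y0 /z0 !compA /x0 /yz !pairm1 !pairm2 !m_u comp1m.
by congr (_ \; _); apply: prd_eq; rewrite ?pairm1 ?pairm2 !comp1m.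
Qed.

(** Linear completeness gives a flow of [Delta C]; the exponential is the
    trajectory of [u]. *)
Lemma exp_exists : exists e : C ~> C, solution1 c1 c0 (Delta C) u e.
Proof.
have [gam [g0 g1]] : complete c1 c0 (Delta C).
  apply: (dco_complete (Delta_linear C)).
  exists (bang _); split; first exact: one_eq.
  exact: tl_unique (T_one_lim X) _ _ _.
pose e := ⟨idm C, uAt C⟩ \; gam.
exists e; split.
  rewrite c0E compA pairm1 /e compA comp_pair comp_uAt compm1.
  have -> : ⟨zeroAt one C, uAt one⟩ = u \; ⟨zeroAt C C, idm C⟩.
    rewrite comp_pair comp_zero compm1 /uAt.
    by congr ⟨_, _⟩; rewrite -[RHS]comp1m; congr (_ \; _); exact: one_eq.
  by move: g0; rewrite c0E -compA => ->; rewrite compm1.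
have c1T : c1 \; fmap T ⟨idm C, uAt C⟩
    = ⟨idm C, uAt C⟩ \; (c1 ⊗ zeroT C) \; Tjoin C C.
  rewrite clock_fieldE c1E tvec_T comp1m comp_tvec comp_pair compm1
    Dat_pair Dat_id.
  by rewrite Dat_const comp_uAt comp_zero.
rewrite /e !fmapM (compA (Tjoin C one)) pl_pair1 compA pairm1 -!compA.
congr (_ \; _); rewrite compA c1T -!compA; congr (_ \; _).
exact: g1.
Qed.

Section Solution.
Context (e : C ~> C) (sol : solution1 c1 c0 (Delta C) u e).

(** The exponential takes 0 to [u] and is its own derivative along [u]. *)
Lemma exp_equations :
  zeta C \; e = u /\ forall Z (x : Z ~> C), Dat e x (uAt Z) = x \; e.
Proof.
case: sol => H0 H1; split.
  rewrite -dco_zeta -[RHS]H0 compA pairm1; congr (_ \; _).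
  by rewrite -[LHS]comp1m; congr (_ \; _); exact: one_eq.
have H : c1 \; fmap T e = e \; Delta C.
  have /(congr1 (fun h => ⟨idm C, bang C⟩ \; h)) := H1.
  rewrite fmapM -!compA (compA (Tjoin C one)) pl_pair1 !compA.
  by rewrite pairm_map !pairm1 !comp1m.
move=> Z x; rewrite DatE.
have -> : tvec x (uAt Z) = x \; c1 by rewrite c1E comp_tvec compm1 comp_uAt.
by rewrite -(compA x) (compA c1) H -compA pl_pair2 compm1.
Qed.

Lemma exp_zero Z : zeroAt Z C \; e = uAt Z.
Proof. by rewrite /zeroAt -compA (proj1 exp_equations). Qed.

Lemma Dat_exp_u Z (x : Z ~> C) : Dat e x (uAt Z) = x \; e.
Proof. exact: (proj2 exp_equations). Qed.

(** The derivative of [e] at 0 is linear and fixes [u], so is the identity. *)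
Lemma Dat_exp_0 Z (v : Z ~> C) : Dat e (zeroAt Z C) v = v.
Proof.
pose k : C ~> C := Dat e (zeroAt C C) (idm C).
(* The second factor is a dummy parameter. *)
suff /(congr1 (fun h => ⟨v, v⟩ \; h)) : prd1 C C \; k = prd1 C C.
  by rewrite compA pairm1 /k comp_Dat comp_zero compm1.
apply: lin1_unique.
- move=> Z' x a y; rewrite compA Dat_comp Dat_prd1 !pairm1.
  rewrite [in LHS]/k [X in Dat X]/Dat Dat_comp Dat_pair Dat_id
    Dat_const comp_pair.
  by rewrite comp_zero compm1 Dat_D_lin /k comp_Dat comp_zero compm1.
- by move=> Z' x a y; rewrite Dat_prd1 !pairm1.
rewrite compA pairm1 /k comp_Dat comp_zero compm1 Dat_exp_u.
by rewrite exp_zero.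
Qed.

(** Both sides, as functions of the first variable, solve the system of [Delta C]
    with initial value [e]; for the left one this uses the symmetry of second
    derivatives. *)
Lemma exp_add : (idm C ⊗ e) \; D e = sigma C \; e.
Proof.
(* The equation [D e (x, u) = e x], differentiated in the direction [w]. *)
have De_u Z (x w : Z ~> C) : Dat (D e) ⟨x, uAt Z⟩ ⟨w, zeroAt Z C⟩ = Dat e x w.
  have E : ⟨idm C, uAt C⟩ \; D e = e by rewrite -/(Dat _ _ _) Dat_exp_u comp1m.
  rewrite -[e in RHS]E Dat_comp Dat_pair Dat_id Dat_const comp_pair compm1.
  by rewrite comp_uAt.
apply: (@system_unique C C (idm C)).
- rewrite !(compA ⟨_, _⟩) pairm_map compm1 comp1m -/(Dat e _ _) Dat_exp_0.
  by rewrite -[_ \; sigma C]/(add _ _) add0x comp1m.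
- rewrite Dat_comp Dat_pair !Dat_comp Dat_id !Dat_prd1 !Dat_prd2 !pairm1
    !pairm2 Dat0.
  rewrite comp1m compm1 /prd_map compm1 Dat_D_sym De_u.
  exact: erefl.
- rewrite Dat_comp Dat_sigma -/(add _ _) addx0 Dat_exp_u comp1m compm1 //.
Qed.

(** The product of [x] and [y] is the mixed second derivative
    D(D(e)) ((0, x), (y, 0)). *)
Definition mul : C ** C ~> C :=
  (⟨zeroAt C C, idm C⟩ ⊗ ⟨idm C, zeroAt C C⟩) \; D2 e.

Lemma mulE Z (x y : Z ~> C) :
  ⟨x, y⟩ \; mul = Dat (D e) ⟨zeroAt Z C, x⟩ ⟨y, zeroAt Z C⟩.
Proof. by rewrite /mul compA pairm_map !comp_pair !comp_zero !compm1. Qed.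

Lemma mulC Z (x y : Z ~> C) : ⟨x, y⟩ \; mul = ⟨y, x⟩ \; mul.
Proof. by rewrite !mulE Dat_D_sym. Qed.

(** The derivative of [exp_add] with respect to the first variable, at 0. *)
Lemma mul_exp Z (x y : Z ~> C) : ⟨x \; e, y⟩ \; mul = Dat e x y.
Proof.
have := congr1 (fun f : C ** C ~> C =>
  Dat f ⟨zeroAt Z C, x⟩ ⟨y, zeroAt Z C⟩) exp_add.
rewrite /= !Dat_comp Dat_pair !Dat_comp Dat_id Dat_prd1 Dat_prd2 Dat_sigma
  -!/(add _ _).
rewrite add0x addx0 !pairm1 pairm2 Dat0 pairm_map compm1 => <-.
by rewrite mulE.
Qed.

(** After an exchange of the factors, the first one is the vector of a
    derivative of [D e], so that [Dat_D_lin] applies to [D e]. *)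
Lemma mul_lin : lin1 mul.
Proof.
have mulE2 : mul = ⟨⟨zeroAt _ C, prd2 C C⟩, ⟨prd1 C C, zeroAt _ C⟩⟩ \; D (D e).
  by rewrite -[LHS]comp1m -prd_eta mulC mulE.
move=> Z x a y; rewrite mulC mulE mulE2 Dat_comp !Dat_pair Dat_prd1 Dat_prd2.
rewrite !Dat_const !pairm1 pairm2 !comp_pair pairm1 pairm2 !comp_zero.
rewrite zero_pair Dat_D_lin.
exact: erefl.
Qed.

Lemma mul_u Z (x : Z ~> C) : ⟨uAt Z, x⟩ \; mul = x.
Proof. by rewrite -exp_zero mul_exp Dat_exp_0. Qed.

Lemma mulA Z (x y z : Z ~> C) :
  ⟨⟨x, y⟩ \; mul, z⟩ \; mul = ⟨x, ⟨y, z⟩ \; mul⟩ \; mul.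
Proof. by apply: lin1_assoc; [exact: mul_lin | exact: mul_u]. Qed.

Lemma mul_lin2 Z (x y b : Z ~> C) :
  Dat mul ⟨x, y⟩ ⟨zeroAt Z C, b⟩ = ⟨x, b⟩ \; mul.
Proof.
have swapE : ⟨prd2 C C, prd1 C C⟩ \; mul = mul.
  by rewrite mulC prd_eta comp1m.
rewrite -[in LHS]swapE Dat_comp Dat_pair Dat_prd1 Dat_prd2 comp_pair !pairm1
  !pairm2.
by rewrite mul_lin mulC.
Qed.

Lemma mul_lift :
  (do_lift C ⊗ zeroT C) \; Tjoin C C \; fmap T mul = mul \; do_lift C.
Proof.
rewrite /prd_map -/(tzero C) -[do_lift C]/(tvec (zeroAt C C) (idm C)).
rewrite compA !comp_tvec !comp_zero !compm1 tzeroE tvec_Tjoin tvec_T.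
by rewrite mul_lin prd_eta comp1m (lin1_zero _ mul_lin).
Qed.

Lemma exp_rig : diff_exp_rig C mul (zeta C \; e) e.
Proof.
split=> //.
- split=> [Z x y|Z x y z|Z x]; [exact: mulC|exact: mulA|].
  by rewrite compA -/(zeroAt Z C) exp_zero mul_u.
- exact: mul_lift.
- rewrite /prd_map -/(tzero C) -[do_lift C]/(tvec (zeroAt C C) (idm C)).
  rewrite compA !comp_tvec !comp_zero !compm1 tzeroE tvec_Tjoin tvec_T.
  by rewrite mul_lin2 prd_eta comp1m mulC (lin1_zero _ mul_lin).
- by rewrite /prd_map compm1 mul_exp /Dat prd_eta comp1m.
- by rewrite -exp_add /prd_map compm1 mul_exp.
Qed.

End Solution.
End Exponential.

Theorem corollary5p26 (X : cartesian_tangent_category)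
    (C : diff_curve_object X) :
  (exists! e : C ~> C, solution1 (dco_c1 C) (dco_c0 C) (Delta C) (dco_u C) e)
  /\
  (forall e : C ~> C,
    solution1 (dco_c1 C) (dco_c0 C) (Delta C) (dco_u C) e ->
    diff_exp_map C e /\
    diff_exp_rig C
      ((⟨zeroAt C C, idm C⟩ ⊗ ⟨idm C, zeroAt C C⟩) \; D2 e)
      (zeta C \; e) e).
Proof.
split; last first.
  move=> e sol; split; last exact: exp_rig.
  split; last exact: exp_add.
  exact: Dat_exp_0 sol _ _.
have [e sol] := exp_exists C.
exists e; split=> // e' sol'.
have := co_unique (dco_curve C) (tvec_p (idm C) (idm C)) sol sol'.
by move/(congr1 (fun h => ⟨idm C, bang C⟩ \; h));
  rewrite !compA !pairm1 !comp1m.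
Qed.
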